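(* Fix any trade-off parameter $V>0$. The sequences $\{y^n[t]\}_{t=0}^\infty$ and $\{\mathbf z^n[t]\}_{t=0}^\infty$, $n\in\{1,\dots,N\}$, produced by the proposed algorithm (described in the context) satisfy all the constraints $$\limsup_{T\to\infty}\frac1T\sum_{t=0}^{T-1}\sum_{n=1}^N\mathbb E[z_l^n[t]]\le d_l,\qquad l\in\{1,\dots,L\},$$ and achieve $\mathcal O(1/V)$ near optimality, i.e. $$\limsup_{T\to\infty}\frac1T\sum_{t=0}^{T-1}\sum_{n=1}^N\mathbb E[y^n[t]]\le f_*+\frac{NC_1+C_3}{V},$$ where $f_*$ is the optimal objective value of the problem, $C_1=6Lz_{\max}(Nz_{\max}+d_{\max})B$ and $C_3=(Nz_{\max}+d_{\max})^2L/2$.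
   Context: **Model.** Time is slotted, $t\in\{0,1,2,\dots\}$. There are $N$ renewal systems. The timeline of system $n$ is divided into back-to-back renewal frames; $t_k^n$ is the slot of the $k$-th renewal, $t^n_0=0$, $T_k^n=t_{k+1}^n-t_k^n$ is a (random) positive integer, and $\mathcal T_k^n=\{t_k^n,\dots,t_{k+1}^n-1\}$. At time $t_k^n$ system $n$ chooses a (possibly random, possibly based on the past of all systems) action $\alpha_k^n\in\mathcal A^n$, which determines the distributions of the frame length $T_k^n$, of the performance vectors $\mathbf z^n[t]=(z_1^n[t],\dots,z_L^n[t])$ and of the penalties $y^n[t]$, $t\in\mathcal T_k^n$. Renewal property: given $\alpha_k^n=\alpha^n$, the variables $T_k^n$, $\mathbf z^n[t]$, $y^n[t]$ ($t\in\mathcal T^n_k$) are independent of the information of all systems from the slots before $t_k^n$, with known conditional expectations $\widehat T^n(\alpha^n)=\mathbb E[T_k^n|\alpha_k^n=\alpha^n]$, $\widehat y^n(\alpha^n)=\mathbb E[\sum_{t\in\mathcal T_k^n}y^n[t]\,|\,\alpha_k^n=\alpha^n]$, $\widehat{\mathbf z}^n(\alpha^n)=\mathbb E[\sum_{t\in\mathcal T_k^n}\mathbf z^n[t]\,|\,\alpha_k^n=\alpha^n]$ not depending on $k$. There is an uncontrollable external process $\{\mathbf d[t]\}_{t\ge0}\subseteq\mathbb R^L$, i.i.d. over slots (with $\mathbf d[t]$ independent of the history before slot $t$), with $d_l=\mathbb E[d_l[t]]$. **Problem.** Minimize $\limsup_{T\to\infty}\frac1T\sum_{t=0}^{T-1}\sum_{n=1}^N\mathbb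 E[y^n[t]]$ subject to $\limsup_{T\to\infty}\frac1T\sum_{t=0}^{T-1}\sum_{n=1}^N\mathbb E[z_l^n[t]]\le d_l$ for $l=1,\dots,L$. $f_*$ denotes the infimum objective value over all decision sequences satisfying the constraints. **Standing assumptions.** (1) The problem is feasible. (2) There are constants $y_{\max},z_{\max},d_{\max}$ with $|y^n[t]|\le y_{\max}$, $|z_l^n[t]|\le z_{\max}$, $|d_l[t]|\le d_{\max}$ for all $n,t,l$; and there is a constant $B\ge1$ such that for all $n$, $k$, every $\alpha^n\in\mathcal A^n$ and every $s\in\mathbb N$ with $\Pr(T_k^n\ge s|\alpha_k^n=\alpha^n)>0$, $\mathbb E[(T_k^n-s)^2\,|\,\alpha_k^n=\alpha^n,T_k^n\ge s]\le B$. (3) With $\widehat f^n(\alpha^n)=\widehat y^n(\alpha^n)/\widehat T^n(\alpha^n)$ and $\widehat{\mathbf g}^n(\alpha^n)=\widehat{\mathbf z}^n(\alpha^n)/\widehat T^n(\alpha^n)$, the set $\{(\widehat f^n(\alpha^n),\widehat{\mathbf g}^n(\alpha^n)):\alpha^n\in\mathcal A^n\}$ is compact for each $n$. **Proposed algorithm** (parameter $V>0$). Virtual queues $\mathbf Q[t]=(Q_1[t],\dots,Q_L[t])$ with $Q_l[0]=0$. At the beginning of the $k$-th frame of system $n$, system $n$ observes $\mathbf Q[t_k^n]$ and chooses $\alpha_k^n\in\mathcal A^n$ minimizing $V\widehat f^n(\alpha^n)+\langle\mathbf Q[t_k^n],\widehat{\mathbf g}^n(\alpha^n)\rangle$ over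 $\alpha^n\in\mathcal A^n$. After each slot, $Q_l[t+1]=\max\{Q_l[t]+\sum_{n=1}^Nz_l^n[t]-d_l[t],0\}$ for all $l$. *)

(* Defs.v *)
From HB Require Import structures.
From mathcomp Require Import all_boot all_order all_algebra.
From mathcomp Require Import all_classical all_reals all_analysis.
Import numFieldNormedType.Exports.

Set Implicit Arguments.
Unset Strict Implicit.
Unset Printing Implicit Defensive.

Import Order.TTheory GRing.Theory Num.Theory.

Local Open Scope classical_set_scope.
Local Open Scope ring_scope.

(* What happens during one frame: its length T, the penalties y[t_k + j] and
   the performance vectors z[t_k + j].  Only the entries of index j < T belong
   to the frame; the entries of index j >= T are padding, and the sigma-algebra
   put on frames below cannot see them. *)
Record frame_data (R : realType) (L : nat) := FrameData {
  flen : nat ;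
  fpen : nat -> R ;
  fperf : nat -> 'I_L -> R }.

HB.instance Definition _ (R : realType) (L : nat) :=
  gen_eqMixin (frame_data R L).
HB.instance Definition _ (R : realType) (L : nat) :=
  gen_choiceMixin (frame_data R L).
HB.instance Definition _ (R : realType) (L : nat) :=
  isPointed.Build (frame_data R L) (FrameData 0 (fun=> 0) (fun _ _ => 0)).

Section frames.
Variables (R : realType) (L : nat).

(* A probability on the generated sigma-algebra is exactly a joint law of
   (T, (y[t_k + j], z[t_k + j])_(j < T)). *)
Definition frame_gen : set (set (frame_data R L)) :=
  [set E | exists m : nat, E = [set w | flen w = m]] `|`
  [set E | exists (j : nat) (B : set R), measurable B /\
     E = [set w | (j < flen w)%N /\ B (fpen w j)]] `|`
  [set E | exists (j : nat) (l : 'I_L) (B : set R), measurable B /\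
     E = [set w | (j < flen w)%N /\ B (fperf w j l)]].

End frames.

Notation frame R L := (g_sigma_algebraType (@frame_gen R L)).

(* The data shared by all control policies.  [law M n a] is the law of a frame
   of system n started with the action a; [ext_law] is the law of d[t]. *)
Record renewal_model (R : realType) (N L : nat) := RenewalModel {
  adisp : 'I_N -> measure_display ;
  action : forall n : 'I_N, measurableType (adisp n) ;
  law : forall n : 'I_N, R.-pker (action n) ~> (frame R L) ;
  law_len_gt0 : forall (n : 'I_N) (a : action n),
    law n a [set w | (0 < flen w)%N] = 1%E ;
  ext_law : probability (L.-tuple R) R }.

Section model.
Variables (R : realType) (N L : nat) (M : renewal_model R N L).

Definition That (n : 'I_N) (a : action M n) : R :=
  \int[law M n a]_w (flen w)%:R.
Definition yhat (n : 'I_N) (a : action M n) : R :=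
  \int[law M n a]_w \sum_(j < flen w) fpen w j.
Definition zhat (n : 'I_N) (a : action M n) (l : 'I_L) : R :=
  \int[law M n a]_w \sum_(j < flen w) fperf w j l.

Definition fhat (n : 'I_N) (a : action M n) : R := yhat a / That a.
Definition ghat (n : 'I_N) (a : action M n) (l : 'I_L) : R :=
  zhat a l / That a.

Definition performance_region (n : 'I_N) : set (R * 'rV[R]_L) :=
  [set p | exists a : action M n, p = (fhat a, \row_l ghat a l)].

Definition dmean (l : 'I_L) : R := \int[ext_law M]_v tnth v l.

Definition bounded_model (ymax zmax dmax : R) : Prop :=
  [/\ forall (n : 'I_N) (a : action M n),
        {ae law M n a, forall w : frame R L, forall j : nat,
           (j < flen w)%N -> `|fpen w j| <= ymax},
      forall (n : 'I_N) (a : action M n),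
        {ae law M n a, forall w : frame R L, forall (j : nat) (l : 'I_L),
           (j < flen w)%N -> `|fperf w j l| <= zmax}
    & {ae ext_law M, forall v, forall l : 'I_L, `|tnth v l| <= dmax}].

(* E[f | E], for an event E of positive probability. *)
Definition cond_mean d (T : measurableType d) (mu : {measure set T -> \bar R})
    (E : set T) (f : T -> R) : \bar R :=
  (((fine (mu E))^-1)%:E * \int[mu]_(w in E) (f w)%:E)%E.

Definition residual_bound (B : R) : Prop :=
  forall (n : 'I_N) (a : action M n) (s : nat),
    let E := [set w : frame R L | (s <= flen w)%N] in
    (0 < law M n a E)%E ->
    (cond_mean (law M n a) E (fun w => ((flen w)%:R - s%:R) ^+ 2)%R
       <= B%:E)%E.

(* [renewal n k] is the slot t_k^n and [act n k] the action alpha_k^n.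
   [hist t] is the information of all systems from the slots before t;
   whether a renewal takes place at slot t is determined by these slots. *)
Record trajectory d (Om : measurableType d) := Trajectory {
  hist : nat -> set (set Om) ;
  renewal : 'I_N -> nat -> Om -> nat ;
  act : forall n : 'I_N, nat -> Om -> action M n ;
  pen : 'I_N -> nat -> Om -> R ;
  perf : 'I_N -> nat -> Om -> 'I_L -> R ;
  ext : nat -> Om -> L.-tuple R }.

Section trajectories.
Context d (Om : measurableType d) (P : probability Om R) (X : trajectory Om).

(* The information available just before the slot t_k^n. *)
Definition hist_at (n : 'I_N) (k : nat) : set (set Om) :=
  [set E | forall t : nat,
     hist X t (E `&` [set w | (renewal X n k w <= t)%N])].

Definition frame_at (n : 'I_N) (k : nat) (w : Om) : frame R L :=
  FrameData (renewal X n k.+1 w - renewal X n k w)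
    (fun j => pen X n (renewal X n k w + j) w)
    (fun j => perf X n (renewal X n k w + j) w).

(* The trajectories that some decision sequence can produce.  An action may be
   randomized, hence it is not required to be measurable for the information
   preceding its slot; it belongs to the information preceding the next one.
   [renewal_property] says that the conditional law of the k-th frame of
   system n, given both that information and alpha_k^n, is
   law M n alpha_k^n. *)
Record admissible : Prop := Admissible {
  hist_sigma_algebra : forall t, sigma_algebra [set: Om] (hist X t) ;
  hist_measurable : forall t, hist X t `<=` measurable ;
  hist_mono : forall t, hist X t `<=` hist X t.+1 ;
  renewal0 : forall n w, renewal X n 0%N w = 0%N ;
  renewal_lt : forall n k w, (renewal X n k w < renewal X n k.+1 w)%N ;
  renewal_hist : forall n k t, hist X t [set w | (renewal X n k w <= t)%N] ;
  act_measurable : forall n k, measurable_fun [set: Om] (act X n k) ;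
  act_hist : forall n k t (C : set (action M n)), measurable C ->
    hist X t.+1 (act X n k @^-1` C `&` [set w | (renewal X n k w <= t)%N]) ;
  pen_hist : forall n t (B : set R), measurable B ->
    hist X t.+1 (pen X n t @^-1` B) ;
  perf_hist : forall n t l (B : set R), measurable B ->
    hist X t.+1 [set w | B (perf X n t w l)] ;
  ext_hist : forall t (B : set (L.-tuple R)), measurable B ->
    hist X t.+1 (ext X t @^-1` B) ;
  renewal_property : forall n k (E : set Om) (C : set (action M n))
      (F : set (frame R L)),
    hist_at n k E -> measurable C -> measurable F ->
    P (E `&` act X n k @^-1` C `&` frame_at n k @^-1` F) =
    (\int[P]_(w in E `&` act X n k @^-1` C) law M n (act X n k w) F)%E ;
  ext_iid : forall t (E : set Om) (B : set (L.-tuple R)),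
    hist X t E -> measurable B ->
    P (E `&` ext X t @^-1` B) = (P E * ext_law M B)%E }.

Definition limsup_average (u : nat -> \bar R) : \bar R :=
  limn_esup (fun T => ((T%:R^-1)%:E * \sum_(t < T) u t)%E).

Definition penalty_cost : \bar R :=
  limsup_average (fun t => (\sum_(n < N) 'E_P[pen X n t])%E).

Definition performance_cost (l : 'I_L) : \bar R :=
  limsup_average (fun t => (\sum_(n < N) 'E_P[fun w => perf X n t w l])%E).

Definition satisfies_constraints : Prop :=
  forall l : 'I_L, (performance_cost l <= (dmean l)%:E)%E.

Fixpoint queue (t : nat) (w : Om) (l : 'I_L) : R :=
  if t is t'.+1 then
    Num.max (queue t' w l + \sum_(n < N) perf X n t' w l
             - tnth (ext X t' w) l) 0
  else 0.

Definition follows_algorithm (V : R) : Prop :=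
  forall (n : 'I_N) (k : nat) (w : Om) (a : action M n),
    let Q := queue (renewal X n k w) w in
    V * fhat (act X n k w) + \sum_(l < L) Q l * ghat (act X n k w) l
      <= V * fhat a + \sum_(l < L) Q l * ghat a l.

End trajectories.

(* The objective values of the decision sequences satisfying the constraints;
   the probability space carrying the randomness is not fixed in advance. *)
Definition feasible_values : set (\bar R) :=
  [set v | exists (d : measure_display) (Om : measurableType d)
     (P : probability Om R) (X : trajectory Om),
     [/\ admissible P X, satisfies_constraints P X & v = penalty_cost P X]].

Definition feasible : Prop := feasible_values !=set0.

Definition fstar : \bar R := ereal_inf feasible_values.

End model.

(* Main.v *)
Require Import Defs.
From HB Require Import structures.
From mathcomp Require Import all_boot all_order all_algebra.
From mathcomp Require Import all_classical all_reals all_analysis.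
From mathcomp Require Import finmap measurable_realfun.
From mathcomp Require Import ring lra zify.
Import numFieldNormedType.Exports.
Import HBNNSimple.

Set Implicit Arguments.
Unset Strict Implicit.
Unset Printing Implicit Defensive.

Import Order.TTheory GRing.Theory Num.Theory.

Local Open Scope classical_set_scope.
Local Open Scope ring_scope.

(** The order of choices matters. The error of a comparison pair must be uniform over all weights
    that the algorithm can meet. For a fixed horizon T the queues stay in the box [0, cT], so the
    pair can be chosen after T, once and for all paths. Renewal slots are random, whereas histories
    are indexed by deterministic slots. Every mean is therefore cut along the events t_k = s: there
    the weight Q[s] is measurable for [hist X s], and the information before the k-th renewal
    reduces to [hist X s]. Actions may be randomized, so the conditional law of a frame is allowed
    to depend on more than this history. The overshoot of a frame is bounded by B times the
    probability that the frame reaches T, not by B. At most one frame of each system starts before T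
    and ends at T or later, so these probabilities sum to at most 1 and a single overshoot is paid
    per system. At most T frames start before T, each lasting at least one slot; this gives the
    factor T of the other error. *)

(* Drift-plus-penalty with frames of random length.  Put c = N zmax + dmax.

   Within the k-th frame of system n, replace Q[t] by Q[t_k]: since |Q_l| moves
   by at most c per slot, this costs L c zmax T_k^2, of mean at most
   L c zmax B.  Conditionally on the past and on the action, the completed
   frame contributes T^ (V (f^ - f) + <Q[t_k], g^ - g>), which is nonpositive
   as soon as (f, g) does not beat the chosen action for the weights Q[t_k].
   The frame straddling the horizon T overshoots it by at most B on average
   (residual life bound) and Q <= c T there, whence a second error
   2 L c zmax B T.  Summing the quadratic drift of Q over t < T gives
     E|Q[T]|^2 / 2 + V (sum of E y - T fstar) <= (C3 + N C1) T + O(1).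
   Dividing by V T gives near-optimality; and E|Q[T]|^2 = O(T) forces
   E Q[T] = o(T), hence the constraints.

   No optimal stationary policy is needed: the comparison pair (f^n, g^n) is
   the time average, up to a large horizon T', of an arbitrary feasible
   trajectory.  The same frame estimate with constant weights shows that it
   beats no action by more than O(1/T'), and letting T' grow for fixed T
   removes the error. *)

(** * Conditioning on a history *)

Section tower.
Context (R : realType).
Local Open Scope ereal_scope.

(** The standard machine as an induction principle. All the cases stay among nonnegative functions,
    so identities between integrals in [\bar R] can be proved by it without integrability
    conditions. *)
Lemma ge0_measurable_ind d (T : measurableType d) (Pr : (T -> \bar R) -> Prop) :
  (forall A, measurable A -> Pr (fun x => (\1_A x)%:E)) ->
  (forall (c : R) (f : T -> \bar R), (0 <= c)%R -> measurable_fun [set: T] f ->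
     (forall x, 0 <= f x) -> Pr f -> Pr (fun x => c%:E * f x)) ->
  (forall f g : T -> \bar R, measurable_fun [set: T] f -> (forall x, 0 <= f x) ->
     measurable_fun [set: T] g -> (forall x, 0 <= g x) ->
     Pr f -> Pr g -> Pr (fun x => f x + g x)) ->
  (forall f_ : nat -> T -> \bar R, (forall n, measurable_fun [set: T] (f_ n)) ->
     (forall n x, 0 <= f_ n x) -> (forall x, nondecreasing_seq (f_ ^~ x)) ->
     (forall n, Pr (f_ n)) -> Pr (fun x => limn (f_ ^~ x))) ->
  forall f : T -> \bar R, measurable_fun [set: T] f ->
  (forall x, 0 <= f x) -> Pr f.
Proof.
move=> Pind Pscale Padd Plim f mf f0.
pose g := nnsfun_approx measurableT mf.
have -> : f = fun x => limn (fun n => (g n x)%:E).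
  apply/funext => x; apply/esym/cvg_lim => //.
  exact: (cvg_nnsfun_approx measurableT mf (fun x _ => f0 x)).
apply: (Plim (fun n x => (g n x)%:E)).
- by move=> n; apply/measurable_EFinP.
- by move=> n x; rewrite lee_fin.
- by move=> x m n mn; rewrite lee_fin; exact/lefP/nd_nnsfun_approx.
move=> n; set h := g n.
(* A simple function is a finite combination of indicators of its level sets; the number of terms is
   then freed, so that the induction adds one term at a time. *)
rewrite (_ : (fun x => (h x)%:E) = (fun x => (\sum_(i < #|` fset_set (range h)|)
   ((fset_set (range h))`_i * \1_(h @^-1` [set (fset_set (range h))`_i]) x)%R)%:E));
  last by apply/funext => x; rewrite {1}(fimfunEord h x).
(* Indices beyond the range give the default entry 0, so nonnegativity holds for every [i]. *)
have h0 (i : nat) : (0 <= (fset_set (range h))`_i)%R.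
  have [ilt|ige] := ltnP i #|` fset_set (range h)|; last by rewrite nth_default.
  have : (fset_set (range h))`_i \in (fset_set (range h)) by exact: mem_nth.
  by rewrite in_fset_set// => /set_mem[x _ <-].
elim: #|` _| => [|m IHm].
  rewrite (_ : (fun _ => _) = (fun x => (\1_set0 x)%:E)); first exact: Pind.
  by apply/funext => x; rewrite big_ord0 indic0.
under eq_fun do rewrite big_ord_recr/= EFinD EFinM.
have mpre (i : nat) : measurable (h @^-1` [set (fset_set (range h))`_i]).
  exact: measurable_sfunP.
apply: Padd => //.
- apply/measurable_EFinP; apply: measurable_sum => i.
  by apply: measurable_funM => //; exact: measurable_indic.
- move=> x; rewrite lee_fin sumr_ge0// => i _.
  by rewrite mulr_ge0// indicE.
- by apply: measurable_funeM; apply/measurable_EFinP; exact: measurable_indic.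
- by move=> x; rewrite -EFinM lee_fin mulr_ge0// indicE.
- apply: Pscale => //; last exact: Pind.
  by apply/measurable_EFinP; exact: measurable_indic.
Qed.

(** An infinite [h] is allowed. The only danger is the product of 0 and [+oo], and a zero limit
    forces every term of a nonnegative nondecreasing sequence to be 0. *)
Lemma nondecreasing_limeMr (u : nat -> \bar R) (h : \bar R) :
  nondecreasing_seq u -> (forall n, 0 <= u n) -> 0 <= h ->
  limn (fun n => u n * h) = limn u * h.
Proof.
move=> ndu u0 h0; have cu : cvgn u by exact: ereal_nondecreasing_is_cvgn.
have [hfin|hinf] := boolP (h \is a fin_num); first exact: limeMr.
have ule n : u n <= limn u.
  by apply: lime_ge => //; near=> m; apply: ndu; near: m; exists n.
have [lu0|lu0] := eqVneq (limn u) 0.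
  rewrite lu0 mul0e; apply/cvg_lim => //.
  rewrite (_ : (fun n => _) = cst 0); first exact: cvg_cst.
  apply/funext => n; rewrite (_ : u n = 0) ?mul0e//.
  by apply/eqP; rewrite eq_le u0 -lu0 ule.
have ch : cvgn (fun=> h) by exact: is_cvg_cst.
rewrite (limeM cu ch) ?lim_cst//.
by rewrite mule_def_neq0_infty.
Unshelve. all: by end_near.
Qed.

Section weighted.
Context d (Om : measurableType d) (P : {measure set Om -> \bar R}).
Variables (G : set (set Om)) (A : set Om).
Hypotheses (sG : sigma_algebra [set: Om] G) (Gm : G `<=` measurable)
  (mA : measurable A).

(** Measurability for a history [G] is expressed by retyping [Om] as [g_sigma_algebraType G]; this
    is the way back to the ambient sigma-algebra. *)
Lemma g_sigma_measurable d' (T : measurableType d')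
    (f : g_sigma_algebraType G -> T) :
  measurable_fun [set: g_sigma_algebraType G] f ->
  measurable_fun [set: Om] (f : Om -> T).
Proof.
move=> mf _ B mB; rewrite setTI.
have := mf measurableT B mB; rewrite setTI.
by rewrite /measurable/= (sigma_algebra_id sG) => /Gm.
Qed.

(** The hypothesis is the case of indicator weights; linearity and monotone convergence extend it to
    all [G]-measurable ones. [h1] and [h2] themselves need not be [G]-measurable. *)
Lemma ge0_integral_weight (h1 h2 : Om -> \bar R) :
  measurable_fun [set: Om] h1 -> (forall w, 0 <= h1 w) ->
  measurable_fun [set: Om] h2 -> (forall w, 0 <= h2 w) ->
  (forall E, G E -> \int[P]_(w in E `&` A) h1 w = \int[P]_(w in E `&` A) h2 w) ->
  forall W : g_sigma_algebraType G -> \bar R,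
  measurable_fun [set: g_sigma_algebraType G] W -> (forall w, 0 <= W w) ->
  \int[P]_(w in A) (W w * h1 w) = \int[P]_(w in A) (W w * h2 w).
Proof.
move=> mh1 h10 mh2 h20 h12.
have mWh (W : g_sigma_algebraType G -> \bar R) (h : Om -> \bar R) :
    measurable_fun [set: g_sigma_algebraType G] W ->
    measurable_fun [set: Om] h ->
    measurable_fun A (fun w : Om => W w * h w).
  move=> mW mh; apply: emeasurable_funM; apply: measurable_funTS => //.
  exact: g_sigma_measurable.
apply: ge0_measurable_ind => //.
- move=> E; rewrite /measurable/= (sigma_algebra_id sG) => GE.
  have eqE (h : Om -> \bar R) : \int[P]_(w in A) ((\1_E w)%:E * h w) =
      \int[P]_(w in E `&` A) h w.
    rewrite integral_mkcondl.
    apply: eq_integral => w _; rewrite patchE indicE.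
    by case: ifPn => _; rewrite ?mul1e ?mul0e.
  by rewrite !eqE; exact: h12.
- move=> c W c0 mW W0 IH.
  under eq_integral do rewrite -muleA.
  under [RHS]eq_integral do rewrite -muleA.
  rewrite !ge0_integralZl_EFin//; first by rewrite IH.
  + by move=> w _; rewrite mule_ge0.
  + exact: mWh.
  + by move=> w _; rewrite mule_ge0.
  + exact: mWh.
- move=> W1 W2 mW1 W10 mW2 W20 IH1 IH2.
  under eq_integral do rewrite ge0_muleDl//.
  under [RHS]eq_integral do rewrite ge0_muleDl//.
  rewrite !ge0_integralD//; try (by move=> w _; rewrite mule_ge0);
    try exact: mWh.
  by rewrite IH1 IH2.
- move=> W_ mW W0 ndW IH.
  have eqL (h : Om -> \bar R) : measurable_fun [set: Om] h -> (forall w, 0 <= h w) ->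
      \int[P]_(w in A) (limn (W_ ^~ w) * h w) =
      limn (fun n => \int[P]_(w in A) (W_ n w * h w)).
    move=> mh h0; rewrite -monotone_convergence//.
    + apply: eq_integral => w _; rewrite nondecreasing_limeMr//.
    + by move=> n; exact: mWh.
    + by move=> n w _; rewrite mule_ge0.
    + by move=> w _ m n mn; rewrite lee_wpmul2r//; exact: ndW.
  rewrite !eqL//; congr (limn _); apply/funext => n; exact: IH.
Qed.

Context d' (Z : measurableType d') (Y : Om -> Z) (kappa : Om -> {measure set Z -> \bar R}).
Hypotheses (mY : measurable_fun [set: Om] Y)
  (mkappa : forall F, measurable F -> measurable_fun [set: Om] (kappa ^~ F))
  (condY : forall E F, G E -> measurable F ->
     P (E `&` A `&` Y @^-1` F) = \int[P]_(w in E `&` A) kappa w F).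

Lemma measurable_integral_kappa (psi : Z -> \bar R) :
  measurable_fun [set: Z] psi -> (forall z, 0 <= psi z) ->
  measurable_fun [set: Om] (fun w => \int[kappa w]_z psi z).
Proof.
move: psi; apply: ge0_measurable_ind.
- move=> F mF.
  rewrite (_ : (fun w => _) = kappa ^~ F); first exact: mkappa.
  by apply/funext => w; rewrite integral_indic// setIT.
- move=> c f c0 mf f0 IH.
  under eq_fun do rewrite ge0_integralZl_EFin//.
  exact: measurable_funeM.
- move=> f g mf f0 mg g0 IHf IHg.
  under eq_fun do rewrite ge0_integralD//.
  exact: emeasurable_funD.
- move=> f_ mf f0 ndf IH.
  under eq_fun do rewrite monotone_convergence//.
  apply: emeasurable_fun_cvg IH _ => w _.
  apply: ereal_nondecreasing_is_cvgn => m n mn.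
  by apply: ge0_le_integral => // z _; exact: ndf.
Qed.

(** [kappa] may depend on more than [G] (in the application, on a randomized action), so this is not
    a conditional expectation given [G] but an equality of integrals against [G]-measurable weights,
    which is all that the drift estimate requires. *)
Lemma tower_ge0 (psi : Z -> \bar R) (W : g_sigma_algebraType G -> \bar R) :
  measurable_fun [set: Z] psi -> (forall z, 0 <= psi z) ->
  measurable_fun [set: g_sigma_algebraType G] W -> (forall w, 0 <= W w) ->
  \int[P]_(w in A) (W w * psi (Y w)) =
  \int[P]_(w in A) (W w * \int[kappa w]_z psi z).
Proof.
move=> mpsi psi0 mW W0.
apply: ge0_integral_weight => //.
- exact: measurableT_comp.
- exact: measurable_integral_kappa.
- by move=> w; exact: integral_ge0.
(* The weight is now the indicator of [E], and [condY] is the case of an indicator [psi]. *)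
move=> E GE; have mEA : measurable (E `&` A) by apply: measurableI => //; exact: Gm.
move: psi mpsi psi0; apply: ge0_measurable_ind.
- move=> F mF; rewrite -[LHS]/(\int[P]_(w in E `&` A) (\1_(Y @^-1` F) w)%:E).
  rewrite integral_indic//; last by rewrite -[Y @^-1` F]setTI; exact: mY.
  rewrite setIC condY//; apply: eq_integral => w _.
  by rewrite integral_indic// setIT.
- move=> c f c0 mf f0 IH.
  under [RHS]eq_integral do rewrite ge0_integralZl_EFin//.
  rewrite !ge0_integralZl_EFin//; try (by move=> w *; exact: integral_ge0);
    try (by apply: measurable_funTS; exact: measurable_integral_kappa);
    try (by apply: measurable_funTS; exact: measurableT_comp).
  by rewrite IH.
- move=> f g mf f0 mg g0 IHf IHg.
  under [RHS]eq_integral do rewrite ge0_integralD//.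
  rewrite [LHS]ge0_integralD// 1?[RHS]ge0_integralD//; try (by move=> w *; exact: integral_ge0);
    try (by apply: measurable_funTS; exact: measurable_integral_kappa);
    try (by apply: measurable_funTS; exact: measurableT_comp).
  by rewrite IHf IHg.
- move=> f_ mf f0 ndf IH.
  under [RHS]eq_integral do rewrite monotone_convergence//.
  rewrite [LHS]monotone_convergence// 1?[RHS]monotone_convergence//;
    try (by congr (limn _); apply/funext => n; exact: IH);
    try (by move=> n; apply: measurable_funTS; exact: measurableT_comp);
    try (by move=> n; apply: measurable_funTS; exact: measurable_integral_kappa);
    try (by move=> w _ m n mn; exact: ndf);
    try (by move=> n w _; exact: integral_ge0).
  by move=> w _ m n mn; apply: ge0_le_integral => // z _; exact: ndf.
Qed.

End weighted.
End tower.

(** * Real-valued integrals under almost-sure bounds *)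

Section Rintegral_ae.
Context d (T : measurableType d) (R : realType) (mu : {measure set T -> \bar R}).
Implicit Types f g : T -> R.

Lemma ae_le_Rintegral f g :
  mu.-integrable [set: T] (EFin \o f) -> mu.-integrable [set: T] (EFin \o g) ->
  {ae mu, forall x, f x <= g x} ->
  \int[mu]_x f x <= \int[mu]_x g x.
Proof.
move=> fi gi fg; rewrite -subr_ge0 -RintegralB//.
have mgf : measurable_fun [set: T] (fun x => g x - f x).
  apply: measurable_funB.
  - by move/measurable_int : gi => /measurable_EFinP.
  - by move/measurable_int : fi => /measurable_EFinP.
(* The difference equals its positive part almost everywhere, and the latter has a nonnegative
   integral. *)
rewrite /Rintegral (ae_eq_integral (fun x => (Num.max (g x - f x) 0)%:E))//.
- by apply: fine_ge0; apply: integral_ge0 => x _; rewrite lee_fin le_max lexx orbT.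
- exact/measurable_EFinP.
- by apply/measurable_EFinP; exact: measurable_maxr.
- by apply: filterS fg => x fgx _; rewrite max_l// subr_ge0.
Qed.

Lemma ae_le_integrable f g :
  measurable_fun [set: T] f -> mu.-integrable [set: T] (EFin \o g) ->
  {ae mu, forall x, `|f x| <= g x} -> mu.-integrable [set: T] (EFin \o f).
Proof.
move=> mf /integrableP[mg gfin] fg; apply/integrableP; split.
  exact/measurable_EFinP.
apply: le_lt_trans gfin; apply: ae_ge0_le_integral => //.
- by apply: measurableT_comp => //; exact/measurable_EFinP.
- exact: measurableT_comp.
- by apply: filterS fg => x fgx _; rewrite lee_fin (le_trans fgx)// ler_norm.
Qed.

Lemma Rintegral_sum (I : Type) (s : seq I) (Q : pred I) (f : I -> T -> R) :
  (forall i, mu.-integrable [set: T] (EFin \o f i)) ->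
  \int[mu]_x (\sum_(i <- s | Q i) f i x) = \sum_(i <- s | Q i) \int[mu]_x f i x.
Proof.
move=> fi; rewrite /Rintegral.
under eq_integral do rewrite -sumEFin.
rewrite (integral_sum measurableT fi) -sum_fine// => i _.
exact: (integrable_fin_num measurableT (fi i)).
Qed.

Lemma integrable_sumr (I : Type) (s : seq I) (Q : pred I) (f : I -> T -> R) :
  (forall i, Q i -> mu.-integrable [set: T] (EFin \o f i)) ->
  mu.-integrable [set: T] (EFin \o (fun x => \sum_(i <- s | Q i) f i x)).
Proof.
move=> fi.
rewrite (_ : _ \o _ = fun x => \sum_(i <- s | Q i) (f i x)%:E)%E.
  exact: integrable_sum.
by apply/funext => x /=; rewrite -sumEFin.
Qed.

Lemma integrable_addr f g :
  mu.-integrable [set: T] (EFin \o f) -> mu.-integrable [set: T] (EFin \o g) ->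
  mu.-integrable [set: T] (EFin \o (fun x => f x + g x)).
Proof. by move=> fi gi; exact: (integrableD measurableT fi gi). Qed.

Lemma integrable_subr f g :
  mu.-integrable [set: T] (EFin \o f) -> mu.-integrable [set: T] (EFin \o g) ->
  mu.-integrable [set: T] (EFin \o (fun x => f x - g x)).
Proof. by move=> fi gi; exact: (integrableB measurableT fi gi). Qed.

Lemma integrable_scaler (c : R) f :
  mu.-integrable [set: T] (EFin \o f) ->
  mu.-integrable [set: T] (EFin \o (fun x => c * f x)).
Proof. by move=> fi; exact: (integrableZl measurableT c fi). Qed.

End Rintegral_ae.

Lemma Rintegral_cst_prob d (T : measurableType d) (R : realType)
  (P : probability T R) (r : R) : \int[P]_w r = r.
Proof.
rewrite (Rintegral_cst _ measurableT).
by have := probability_setT P => /= ->; rewrite mulr1.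
Qed.

Section tower_real.
Context (R : realType) d (Om : measurableType d) (P : probability Om R).
Variables (G : set (set Om)) (A : set Om).
Hypotheses (sG : sigma_algebra [set: Om] G) (Gm : G `<=` measurable)
  (mA : measurable A).
Context d' (Z : measurableType d') (Y : Om -> Z) (kappa : Om -> {measure set Z -> \bar R}).
Hypotheses (mY : measurable_fun [set: Om] Y)
  (mkappa : forall F, measurable F -> measurable_fun [set: Om] (kappa ^~ F))
  (condY : forall E F, G E -> measurable F ->
     P (E `&` A `&` Y @^-1` F) = (\int[P]_(w in E `&` A) kappa w F)%E).
Variables (W : Om -> R) (c C : R).
Hypotheses
  (mW : measurable_fun [set: g_sigma_algebraType G]
     (W : g_sigma_algebraType G -> R))
  (W0 : forall w, 0 <= W w) (Wc : {ae P, forall w, W w <= c}).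

Lemma tower_Rge0 (psi : Z -> R) :
  measurable_fun [set: Z] psi -> (forall z, 0 <= psi z) ->
  (forall w, \int[kappa w]_z (psi z)%:E <= C%:E)%E ->
  [/\ P.-integrable [set: Om] (EFin \o (fun w => \1_A w * (W w * psi (Y w)))),
      P.-integrable [set: Om]
        (EFin \o (fun w => \1_A w * (W w * \int[kappa w]_z psi z)))
    & \int[P]_w (\1_A w * (W w * psi (Y w))) =
      \int[P]_w (\1_A w * (W w * \int[kappa w]_z psi z))].
Proof.
move=> mpsi psi0 psiC.
have mEpsi : measurable_fun [set: Z] (EFin \o psi) by exact/measurable_EFinP.
have psiE w : (\int[kappa w]_z (psi z)%:E)%E = (\int[kappa w]_z psi z)%:E.
  rewrite fineK// ge0_fin_numE; last by apply: integral_ge0 => z _; rewrite lee_fin.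
  by rewrite (le_lt_trans (psiC w))// ltry.
have psibar0 w : 0 <= \int[kappa w]_z psi z by apply: Rintegral_ge0.
have psibarC w : \int[kappa w]_z psi z <= C by rewrite -lee_fin -psiE.
have mpsibar : measurable_fun [set: Om] (fun w => \int[kappa w]_z psi z).
  apply/measurable_EFinP; rewrite (_ : _ \o _ = fun w => \int[kappa w]_z (psi z)%:E)%E.
    by apply: (measurable_integral_kappa mkappa) => // z; rewrite lee_fin.
  by apply/funext => w; rewrite psiE.
have mWP : measurable_fun [set: Om] W by exact: (g_sigma_measurable sG Gm mW).
have mE : measurable_fun [set: Om] (\1_A : Om -> R) by exact: measurable_indic.
have A0 w : 0 <= \1_A w :> R by rewrite indicE.
have A1 w : \1_A w <= 1 :> R by rewrite indicE; case: (_ \in _).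
have mpsiY : measurable_fun [set: Om] (fun w => psi (Y w)) by exact: measurableT_comp.
have towerE : (\int[P]_w (\1_A w * (W w * psi (Y w)))%:E =
    \int[P]_w (\1_A w * (W w * \int[kappa w]_z psi z))%:E)%E.
  have EA (f : Om -> R) : (\int[P]_w (\1_A w * f w)%:E = \int[P]_(w in A) (f w)%:E)%E.
    rewrite [RHS]integral_mkcond; apply: eq_integral => w _; rewrite patchE indicE.
    by case: ifPn; rewrite ?mul1r ?mul0r.
  rewrite !EA.
  under eq_integral do rewrite EFinM.
  under [RHS]eq_integral do rewrite EFinM -psiE.
  apply: (tower_ge0 sG Gm mA mY mkappa condY (psi := EFin \o psi) (W := EFin \o W)) => //;
    try (by move=> z /=; rewrite lee_fin).
  exact/measurable_EFinP.
have m2 : measurable_fun [set: Om] (fun w => \1_A w * (W w * \int[kappa w]_z psi z)).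
  by apply: measurable_funM => //; exact: measurable_funM.
have int2 : P.-integrable [set: Om]
    (EFin \o (fun w => \1_A w * (W w * \int[kappa w]_z psi z))).
  apply: (@ae_le_integrable _ _ _ _ _ (cst (c * C))) => //.
    exact: finite_measure_integrable_cst.
  apply: filterS Wc => w Wcw; rewrite ger0_norm; last first.
    by rewrite mulr_ge0// mulr_ge0.
  rewrite -[leRHS]mul1r ler_pM// ?mulr_ge0//.
  exact: ler_pM.
split=> //; last by rewrite /Rintegral towerE.
apply/integrableP; split.
  by apply/measurable_EFinP; apply: measurable_funM => //; exact: measurable_funM.
(* Nothing bounds [psi (Y w)] pointwise, so its integrability is read off the identity with the
   averaged side, which is bounded. *)
move/integrableP : int2 => [_]; apply: le_lt_trans.
under eq_integral => w _.
  rewrite /= ger0_norm; last by rewrite mulr_ge0// mulr_ge0.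
  over.
rewrite towerE; apply: ge0_le_integral => //.
- by move=> w _; rewrite lee_fin mulr_ge0// mulr_ge0.
- exact/measurable_EFinP.
- by apply: measurableT_comp => //; exact/measurable_EFinP.
- by move=> w _; rewrite lee_fin ler_norm.
Qed.

Lemma tower (psi : Z -> R) :
  measurable_fun [set: Z] psi ->
  (forall w, \int[kappa w]_z `|psi z|%:E <= C%:E)%E ->
  [/\ P.-integrable [set: Om] (EFin \o (fun w => \1_A w * (W w * psi (Y w)))),
      P.-integrable [set: Om]
        (EFin \o (fun w => \1_A w * (W w * \int[kappa w]_z psi z)))
    & \int[P]_w (\1_A w * (W w * psi (Y w))) =
      \int[P]_w (\1_A w * (W w * \int[kappa w]_z psi z))].
Proof.
move=> mpsi psiC.
have psiint w : (kappa w).-integrable [set: Z] (EFin \o psi).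
  apply/integrableP; split; first exact/measurable_EFinP.
  by apply: le_lt_trans (psiC w) _; rewrite ltry.
have mpos : measurable_fun [set: Z] psi^\+ by exact: measurable_funrpos.
have mneg : measurable_fun [set: Z] psi^\- by exact: measurable_funrneg.
have posC w : (\int[kappa w]_z (psi^\+ z)%:E <= C%:E)%E.
  apply: le_trans (psiC w); apply: ge0_le_integral => //;
    try (by move=> z _; rewrite lee_fin);
    try exact/measurable_EFinP;
    try (by apply/measurable_EFinP; exact: measurableT_comp).
  by move=> z _; rewrite lee_fin /funrpos ge_max ler_norm normr_ge0.
have negC w : (\int[kappa w]_z (psi^\- z)%:E <= C%:E)%E.
  apply: le_trans (psiC w); apply: ge0_le_integral => //;
    try (by move=> z _; rewrite lee_fin);
    try exact/measurable_EFinP;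
    try (by apply/measurable_EFinP; exact: measurableT_comp).
  by move=> z _; rewrite lee_fin /funrneg ge_max -normrN ler_norm normr_ge0.
have [ip1 ip2 ep] := tower_Rge0 mpos (fun z => funrpos_ge0 psi z) posC.
have [in1 in2 en] := tower_Rge0 mneg (fun z => funrneg_ge0 psi z) negC.
have psiE : psi = fun z => psi^\+ z - psi^\- z.
  by apply/funext => z; rewrite [LHS](congr1 (@^~ z) (esym (funrposBneg psi))).
have E1 : (fun w => \1_A w * (W w * psi (Y w))) = fun w =>
    \1_A w * (W w * psi^\+ (Y w)) - \1_A w * (W w * psi^\- (Y w)).
  by apply/funext => w; rewrite {1}psiE; ring.
have E2 : (fun w => \1_A w * (W w * \int[kappa w]_z psi z)) = fun w =>
    \1_A w * (W w * \int[kappa w]_z psi^\+ z) - \1_A w * (W w * \int[kappa w]_z psi^\- z).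
  apply/funext => w; rewrite {1}psiE RintegralB//; first by ring.
  - exact: (integrable_funrpos measurableT (psiint w)).
  - exact: (integrable_funrneg measurableT (psiint w)).
rewrite E1 E2; split.
- exact: integrable_subr.
- exact: integrable_subr.
- by rewrite !RintegralB// ep en.
Qed.

End tower_real.

(** * Frames *)

Section frame_measurability.
Context (R : realType) (L : nat).
Implicit Types w : frame R L.

Lemma measurable_flen_eq (m : nat) :
  measurable ([set w | flen w = m] : set (frame R L)).
Proof. by apply: sub_sigma_algebra; left; left; exists m. Qed.

Lemma measurable_fun_flen d (T : measurableType d) (f : nat -> T) :
  measurable_fun [set: frame R L] (fun w => f (flen w)).
Proof.
move=> _ B mB; rewrite setTI.
rewrite (_ : _ @^-1` _ = \bigcup_(i in [set i | B (f i)]) [set w | flen w = i]).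
  by apply: bigcup_measurable => i _; exact: measurable_flen_eq.
apply/seteqP; split=> [w Bw|w [i /= Bi wi]]; first by exists (flen w).
by rewrite /preimage/= wi.
Qed.

Lemma measurable_flen_ge (m : nat) :
  measurable ([set w | (m <= flen w)%N] : set (frame R L)).
Proof.
have := @measurable_fun_flen _ _ (leq m) measurableT [set true].
by rewrite setTI; apply.
Qed.

(** The generators see [h] only when slot [j] lies inside the frame; replacing the padding by 0
    leaves a function that they determine. *)
Lemma measurable_fun_slot (j : nat) (h : frame R L -> R) :
  (forall B : set R, measurable B ->
     measurable ([set w | (j < flen w)%N /\ B (h w)] : set (frame R L))) ->
  measurable_fun [set: frame R L] (fun w => if (j < flen w)%N then h w else 0).
Proof.
move=> mh _ B mB; rewrite setTI.
rewrite (_ : _ @^-1` _ = [set w | (j < flen w)%N /\ B (h w)] `|`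
    (~` [set w | (j < flen w)%N] `&` [set w | B 0])).
  apply: measurableU; first exact: mh.
  apply: measurableI; first by apply: measurableC; exact: measurable_flen_ge.
  have [B0|B0] := pselect (B 0).
    by rewrite (_ : [set _ | _] = setT)//; apply/seteqP; split.
  by rewrite (_ : [set _ | _] = set0)//; apply/seteqP; split.
apply/seteqP; split=> w; rewrite /preimage/=.
- by case: ifPn => [jw Bh|jw B0]; [left|right].
- by case=> [[-> //]|[/negP/negbTE -> //]].
Qed.

Lemma measurable_frame_sum (h : nat -> frame R L -> R) :
  (forall j, measurable_fun [set: frame R L]
     (fun w => if (j < flen w)%N then h j w else 0)) ->
  measurable_fun [set: frame R L] (fun w => \sum_(j < flen w) h j w).
Proof.
move=> mh _ B mB; rewrite setTI.
pose g m w := \sum_(j < m) if (j < flen w)%N then h j w else 0.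
have mg m : measurable_fun [set: frame R L] (g m).
  by apply: measurable_sum => j; exact: mh.
rewrite (_ : _ @^-1` _ = \bigcup_m ([set w | flen w = m] `&` g m @^-1` B)).
  apply: bigcup_measurable => m _; apply: measurableI.
    exact: measurable_flen_eq.
  by rewrite -[X in measurable X]setTI; exact: (mg m measurableT B mB).
have gE w : g (flen w) w = \sum_(j < flen w) h j w.
  by apply: eq_bigr => j _; rewrite ltn_ord.
apply/seteqP; split=> [w Bw|w [m _ [/= wm]]].
  by exists (flen w) => //; split=> //=; rewrite gE.
by rewrite /preimage/= -wm gE.
Qed.

(** Affine in [y] and [z]: suitable coefficients recover the length, the penalty and each
    performance sum of a frame, so one family of bounds serves all of them. *)
Definition slot_reward (a b : R) (e : 'I_L -> R) (y : R) (z : 'I_L -> R) : R :=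
  a + b * y + \sum_l e l * z l.

Definition frame_reward a b e w : R :=
  \sum_(j < flen w) slot_reward a b e (fpen w j) (fperf w j).

Lemma measurable_frame_reward a b e :
  measurable_fun [set: frame R L] (frame_reward a b e).
Proof.
apply: (measurable_frame_sum
  (h := fun j w => slot_reward a b e (fpen w j) (fperf w j))) => j.
rewrite (_ : (fun w => _) = fun w =>
    slot_reward (if (j < flen w)%N then a else 0) b e
      (if (j < flen w)%N then fpen w j else 0)
      (fun l => if (j < flen w)%N then fperf w j l else 0)); last first.
  apply/funext => w; case: ifP => // _; rewrite /slot_reward mulr0 !add0r.
  by rewrite big1// => l _; rewrite mulr0.
apply: measurable_funD; first apply: measurable_funD.
- exact: (measurable_fun_flen (fun m => if (j < m)%N then a else 0)).
- apply: measurable_funM => //; apply: measurable_fun_slot => B mB.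
  by apply: sub_sigma_algebra; left; right; exists j, B.
- apply: measurable_sum => l; apply: measurable_funM => //.
  apply: (measurable_fun_slot (h := fun w => fperf w j l)) => B mB.
  by apply: sub_sigma_algebra; right; exists j, l, B.
Qed.

End frame_measurability.

(** * Moments of one frame under its law *)

Section model_bounds.
Context (R : realType) (N L : nat) (M : renewal_model R N L).
Variables (ymax zmax dmax B : R).
Hypotheses (hbounded : bounded_model M ymax zmax dmax) (hB : 1 <= B)
  (hresidual : residual_bound M B).
Implicit Types (n : 'I_N).

Lemma law_setT n (a : action M n) : law M n a [set: frame R L] = 1%E.
Proof. exact: prob_kernel. Qed.

Lemma law_fin n (a : action M n) F : measurable F -> law M n a F \is a fin_num.
Proof.
move=> mF; rewrite ge0_fin_numE// (@le_lt_trans _ _ 1%E) ?ltry//.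
by rewrite -(law_setT a) le_measure// ?mem_set.
Qed.

Lemma law_integrable_cst n (a : action M n) (r : R) :
  (law M n a).-integrable [set: frame R L] (EFin \o cst r).
Proof.
apply/integrableP; split; first by apply/measurable_EFinP.
rewrite /= integral_cst//= law_setT mule1 ltry//.
Qed.

(** Product form of the conditional bound, which survives when the event is null. *)
Lemma residual_integral n (a : action M n) (s : nat) :
  (\int[law M n a]_(w in [set w : frame R L | (s <= flen w)%N])
      (((flen w)%:R - s%:R) ^+ 2)%:E
    <= B%:E * law M n a [set w : frame R L | (s <= flen w)%N])%E.
Proof.
set E := [set w | _]; have mE : measurable E by exact: measurable_flen_ge.
have Efin := law_fin a mE.
have [E0|E0] := eqVneq (law M n a E) 0%E.
  rewrite (null_set_integral mE)//.
    by rewrite E0 mule0.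
  apply: measurable_funTS; apply/measurable_EFinP.
  exact: (measurable_fun_flen (fun m => (m%:R - s%:R : R) ^+ 2)).
have Egt0 : (0 < law M n a E)%E by rewrite lt0e E0/=.
have := hresidual Egt0; rewrite /cond_mean -/E.
rewrite lee_pdivrMl ?fine_gt0//; last by rewrite Egt0 ltey_eq Efin.
by rewrite fineK// muleC.
Qed.

Lemma flen_sqr_integral n (a : action M n) :
  (\int[law M n a]_w ((flen w)%:R ^+ 2)%:E <= B%:E)%E.
Proof.
have := residual_integral a 0%N.
rewrite (_ : [set w | _] = setT); last by apply/seteqP; split.
by under eq_integral do rewrite subr0; rewrite law_setT mule1.
Qed.

(** An integer is at most its square, and the overshoot vanishes off the event [s <= flen w].
    Keeping the probability of this event on the right, rather than 1, is what makes the overshoots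
    summable over the frames. *)
Lemma flen_overshoot_integral n (a : action M n) (s : nat) :
  (\int[law M n a]_w ((flen w - s)%N%:R)%:E
    <= B%:E * law M n a [set w : frame R L | (s <= flen w)%N])%E.
Proof.
apply: le_trans (residual_integral a s).
rewrite [leRHS]integral_mkcond; apply: ge0_le_integral => //.
- apply/measurable_EFinP; exact: (measurable_fun_flen (fun m => (m - s)%N%:R : R)).
- apply/measurable_restrict => //; first exact: measurable_flen_ge.
  apply: measurable_funTS; apply/measurable_EFinP.
  exact: (measurable_fun_flen (fun m => (m%:R - s%:R : R) ^+ 2)).
- move=> w _; rewrite patchE; case: ifPn => [|].
    move=> /set_mem/= sw; rewrite lee_fin natrB// -natrB//.
    by rewrite -natrX ler_nat; case: (_ - _)%N => // k; rewrite leq_pmulr.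
  by rewrite notin_setE/= => /negP; rewrite -ltnNge => /ltnW/eqP ->.
Qed.

Lemma flen_integral n (a : action M n) :
  (\int[law M n a]_w ((flen w)%:R)%:E <= B%:E)%E.
Proof.
have := flen_overshoot_integral a 0%N.
rewrite (_ : [set w | _] = setT); last by apply/seteqP; split.
by under eq_integral do rewrite subn0; rewrite law_setT mule1.
Qed.

Lemma measurable_flenR : measurable_fun [set: frame R L] (fun w => (flen w)%:R : R).
Proof. exact: (measurable_fun_flen (fun m => m%:R : R)). Qed.

Lemma flen_integrable n (a : action M n) :
  (law M n a).-integrable [set: frame R L] (EFin \o (fun w => (flen w)%:R : R)).
Proof.
apply/integrableP; split; first by apply/measurable_EFinP; exact: measurable_flenR.
under eq_integral do rewrite /= ger0_norm//.
by rewrite (le_lt_trans (flen_integral a))// ltry.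
Qed.

Lemma That_le n (a : action M n) : That a <= B.
Proof.
rewrite -lee_fin /That /Rintegral fineK ?flen_integral//.
exact: (integrable_fin_num measurableT (flen_integrable a)).
Qed.

Lemma That_ge1 n (a : action M n) : 1 <= That a.
Proof.
rewrite (_ : 1 = \int[law M n a]_(w in [set: frame R L]) (cst (1 : R)) w); last first.
  by rewrite Rintegral_cst// law_setT mulr1.
apply: ae_le_Rintegral; [exact: law_integrable_cst|exact: flen_integrable|].
exists [set w | flen w = 0%N]; split; first exact: measurable_flen_eq.
  have := law_len_gt0 a; set E := [set w | _] => E1.
  have mE : measurable (E : set (frame R L)) by exact: measurable_flen_ge.
  rewrite (_ : [set w | _] = ~` E); last first.
    apply/seteqP; split => w /=; rewrite /E/=; first by move=> ->.
    by move/negP; rewrite -leqNgt leqn0 => /eqP.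
  have : law M n a (E `|` ~` E) = (law M n a E + law M n a (~` E))%E.
    by apply: measureU => //; [exact: measurableC|rewrite setICr].
  rewrite setUv law_setT E1 addeC => /(congr1 (fun x => x - 1)%E).
  by rewrite addeK// subee.
move=> w /= /negP; rewrite -ltNge ltrn1.
by rewrite ltnS leqn0 => /eqP.
Qed.

End model_bounds.

Section reward_bounds.
Context (R : realType) (N L : nat) (M : renewal_model R N L).
Variables (ymax zmax dmax B : R).
Hypotheses (hbounded : bounded_model M ymax zmax dmax) (hB : 1 <= B)
  (hresidual : residual_bound M B).
Implicit Types (n : 'I_N).

(** Source of the signs of [ymax] and [zmax]: the bounds hold only almost surely and inside a frame,
    so a frame with at least one slot has to be exhibited. *)
Lemma frame_ae_exists n (a : action M n) (Q : frame R L -> Prop) :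
  {ae law M n a, forall w, Q w} -> exists2 w, (0 < flen w)%N & Q w.
Proof.
move=> Qae; apply: contrapT => nQ.
have : law M n a [set w | (0 < flen w)%N] = 0%E.
  have [A [mA A0 QA]] := Qae.
  apply: (subset_measure0 _ _ _ A0) => //; first exact: measurable_flen_ge.
  by move=> w /= w0; apply: QA => /= Qw; apply: nQ; exists w.
by rewrite law_len_gt0 => /eqP; rewrite onee_eq0.
Qed.

Lemma ymax_ge0 n (a : action M n) : 0 <= ymax.
Proof.
have [hy _ _] := hbounded; have [w w0 yw] := frame_ae_exists (hy n a).
by rewrite (le_trans _ (yw 0%N w0)).
Qed.

Lemma zmax_ge0 n (a : action M n) (l : 'I_L) : 0 <= zmax.
Proof.
have [_ hz _] := hbounded; have [w w0 zw] := frame_ae_exists (hz n a).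
by rewrite (le_trans _ (zw 0%N l w0)).
Qed.

Lemma dmax_ge0 (l : 'I_L) : 0 <= dmax.
Proof.
have [_ _ [A [mA A0 dA]]] := hbounded; apply: contrapT => nd.
suff AT : A = setT by move: A0; rewrite AT probability_setT => /eqP; rewrite onee_eq0.
apply/seteqP; split=> // v _; apply: dA => /= /(_ l) dv.
by apply: nd; rewrite (le_trans _ dv).
Qed.

Definition reward_max (a b : R) (e : 'I_L -> R) : R :=
  `|a| + `|b| * ymax + \sum_l `|e l| * zmax.

Lemma reward_max_ge0 n (x : action M n) a b e : 0 <= reward_max a b e.
Proof.
rewrite addr_ge0 ?addr_ge0 ?mulr_ge0 ?(ymax_ge0 x)//.
by apply: sumr_ge0 => l _; rewrite mulr_ge0 ?(zmax_ge0 x l).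
Qed.

Lemma slot_reward_le a b e y z : `|y| <= ymax -> (forall l, `|z l| <= zmax) ->
  `|slot_reward a b e y z| <= reward_max a b e.
Proof.
move=> yy zz; rewrite (le_trans (ler_normD _ _))// lerD//.
  by rewrite (le_trans (ler_normD _ _))// lerD// normrM ler_wpM2l.
rewrite (le_trans (ler_norm_sum _ _ _))// ler_sum// => l _.
by rewrite normrM ler_wpM2l.
Qed.

Lemma frame_reward_le n (x : action M n) a b e :
  {ae law M n x, forall w, `|frame_reward a b e w| <= reward_max a b e * (flen w)%:R}.
Proof.
have [hy hz _] := hbounded.
apply: filterS2 (hy n x) (hz n x) => w yw zw.
rewrite (le_trans (ler_norm_sum _ _ _))//.
rewrite (@le_trans _ _ (\sum_(j < flen w) reward_max a b e))//.
  apply: ler_sum => j _; apply: slot_reward_le; first exact: yw.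
  by move=> l; exact: zw.
by rewrite sumr_const card_ord mulr_natr.
Qed.

Lemma frame_reward_abs n (x : action M n) a b e :
  (\int[law M n x]_w `|frame_reward a b e w|%:E <= (reward_max a b e * B)%:E)%E.
Proof.
have r0 := reward_max_ge0 x a b e.
apply: (@le_trans _ _ (\int[law M n x]_w ((reward_max a b e * (flen w)%:R)%:E))%E).
  apply: ae_ge0_le_integral => //.
  - apply/measurable_EFinP; apply: measurableT_comp => //.
    exact: measurable_frame_reward.
  - by move=> w _; rewrite lee_fin mulr_ge0.
  - apply/measurable_EFinP; apply: measurable_funM => //.
    exact: measurable_flenR.
  - by apply: filterS (frame_reward_le x a b e) => w hw _; rewrite lee_fin.
under eq_integral do rewrite EFinM.
rewrite ge0_integralZl_EFin//.
  by rewrite EFinM lee_wpmul2l ?lee_fin//; exact: flen_integral.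
by apply/measurable_EFinP; exact: measurable_flenR.
Qed.

Lemma frame_reward_integrable n (x : action M n) a b e :
  (law M n x).-integrable [set: frame R L] (EFin \o frame_reward a b e).
Proof.
apply/integrableP; split; first by apply/measurable_EFinP; exact: measurable_frame_reward.
by rewrite (le_lt_trans (frame_reward_abs x a b e))// ltry.
Qed.

(** Renewal-reward identity: a frame earns its mean length times the rate. It turns the minimization
    of ratios by the algorithm into a sign for the mean over a whole frame. *)
Lemma frame_reward_integral n (x : action M n) a b e :
  \int[law M n x]_w frame_reward a b e w =
  That x * (a + b * fhat x + \sum_l e l * ghat x l).
Proof.
have T0 : That x != 0 by rewrite gt_eqF// (lt_le_trans _ (That_ge1 hresidual x)).
pose y w := frame_reward 0 1 (fun=> 0 : R) (w : frame R L).
pose z l w := frame_reward 0 0 (fun l' : 'I_L => (l' == l)%:R : R) (w : frame R L).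
have yE w : y w = \sum_(j < flen w) fpen w j.
  apply: eq_bigr => j _; rewrite /slot_reward add0r mul1r big1 ?addr0// => l _.
  by rewrite mul0r.
have zE l w : z l w = \sum_(j < flen w) fperf w j l.
  apply: eq_bigr => j _; rewrite /slot_reward add0r mul0r add0r (bigD1 l)//= eqxx mul1r.
  by rewrite big1 ?addr0// => i /negbTE ->; rewrite mul0r.
have E : frame_reward a b e = fun w : frame R L =>
    (a * (flen w)%:R + b * y w) + \sum_l e l * z l w.
  apply/funext => w; rewrite /frame_reward /slot_reward !big_split/=.
  rewrite sumr_const card_ord mulr_natr -mulr_sumr yE; congr (_ + _).
  by rewrite exchange_big/=; apply: eq_bigr => l _; rewrite -mulr_sumr zE.
have ifl := flen_integrable hresidual x.
have iy : (law M n x).-integrable setT (EFin \o y) by exact: frame_reward_integrable.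
have iz l : (law M n x).-integrable setT (EFin \o z l) by exact: frame_reward_integrable.
have i1 : (law M n x).-integrable setT (EFin \o (fun w : frame R L => a * (flen w)%:R)).
  exact: integrable_scaler.
have i2 : (law M n x).-integrable setT (EFin \o (fun w => b * y w)).
  exact: integrable_scaler.
have i3 l : (law M n x).-integrable setT (EFin \o (fun w => e l * z l w)).
  exact: integrable_scaler.
rewrite E RintegralD//; last 2 first.
- exact: integrable_addr.
- exact: integrable_sumr.
rewrite RintegralD// Rintegral_sum// !RintegralZl//.
have -> : \int[law M n x]_w y w = yhat x by apply: eq_Rintegral => w _.
rewrite !mulrDr; congr (_ + _ + _); first by rewrite mulrC.
  by rewrite mulrCA /fhat (mulrC (yhat x)) mulVKf.
rewrite mulr_sumr; apply: eq_bigr => l _; rewrite RintegralZl//.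
rewrite mulrCA /ghat (mulrC (zhat x l)) mulVKf//; congr (_ * _).
by apply: eq_Rintegral => w _.
Qed.

End reward_bounds.

(** * Admissible trajectories *)

Section trajectory_facts.
Context (R : realType) (N L : nat) (M : renewal_model R N L).
Context d (Om : measurableType d) (P : probability Om R) (X : trajectory M Om).
Hypothesis hX : admissible P X.
Implicit Types (n : 'I_N) (w : Om).

Lemma hist_measurableE t :
  @measurable _ (g_sigma_algebraType (hist X t)) = hist X t.
Proof. exact: (sigma_algebra_id (hist_sigma_algebra hX t)). Qed.

Lemma hist_le s t : (s <= t)%N -> hist X s `<=` hist X t.
Proof.
elim: t => [|t IHt]; first by rewrite leqn0 => /eqP ->.
rewrite leq_eqVlt => /predU1P[-> //|st].
by move=> E hE; apply: (hist_mono hX); exact: IHt.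
Qed.

Lemma hist_fun_le d' (T : measurableType d') (f : Om -> T) s t : (s <= t)%N ->
  measurable_fun setT (f : g_sigma_algebraType (hist X s) -> T) ->
  measurable_fun setT (f : g_sigma_algebraType (hist X t) -> T).
Proof.
move=> st mf _ F mF; have := mf measurableT F mF.
by rewrite !hist_measurableE; exact: hist_le.
Qed.

Lemma hist_fun_measurable d' (T : measurableType d') (f : Om -> T) t :
  measurable_fun setT (f : g_sigma_algebraType (hist X t) -> T) ->
  measurable_fun setT f.
Proof.
exact: (g_sigma_measurable (hist_sigma_algebra hX t) (@hist_measurable _ _ _ _ _ _ _ _ hX t)).
Qed.

Lemma renewal_eq_hist n k t :
  hist X t [set w | renewal X n k w = t].
Proof.
case: t => [|t].
  rewrite (_ : [set _ | _] = [set w | (renewal X n k w <= 0)%N]).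
    exact: (renewal_hist hX).
  by apply/seteqP; split=> w /=; [move=> ->|rewrite leqn0 => /eqP].
rewrite (_ : [set _ | _] = [set w | (renewal X n k w <= t.+1)%N] `\`
    [set w | (renewal X n k w <= t)%N]).
  rewrite -hist_measurableE; apply: measurableD; rewrite hist_measurableE.
    exact: (renewal_hist hX).
  by apply: (hist_mono hX); exact: (renewal_hist hX).
apply/seteqP; split=> w /=; first by move=> ->; rewrite leqnn ltnn.
by case=> + /negP; rewrite -ltnNge => tk kt; apply/eqP; rewrite eqn_leq tk.
Qed.

Lemma measurable_renewal_eq n k s : measurable [set w | renewal X n k w = s].
Proof. by apply: (hist_measurable hX); exact: renewal_eq_hist. Qed.

Lemma pen_fun_hist n t :
  measurable_fun setT (pen X n t : g_sigma_algebraType (hist X t.+1) -> R).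
Proof. by move=> _ F mF; rewrite setTI hist_measurableE; exact: (pen_hist hX). Qed.

Lemma perf_fun_hist n t l : measurable_fun setT
  ((fun w => perf X n t w l) : g_sigma_algebraType (hist X t.+1) -> R).
Proof. by move=> _ F mF; rewrite setTI hist_measurableE; exact: (perf_hist hX). Qed.

Lemma ext_fun_hist t : measurable_fun setT
  (ext X t : g_sigma_algebraType (hist X t.+1) -> L.-tuple R).
Proof. by move=> _ F mF; rewrite setTI hist_measurableE; exact: (ext_hist hX). Qed.

Lemma queue_fun_hist t l : measurable_fun setT
  ((fun w => queue X t w l) : g_sigma_algebraType (hist X t) -> R).
Proof.
elim: t l => [|t IHt] l /=; first exact: measurable_cst.
apply: measurable_maxr => //; apply: measurable_funB; first apply: measurable_funD.
- by apply: hist_fun_le (IHt l).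
- by apply: measurable_sum => n; exact: perf_fun_hist.
- apply: (measurableT_comp (measurable_tnth l)).
  exact: ext_fun_hist.
Qed.

Lemma renewal_ge n k w : (k <= renewal X n k w)%N.
Proof.
by elim: k => // k IHk; rewrite (leq_ltn_trans IHk)//; exact: (renewal_lt hX).
Qed.

Lemma renewal_cover n t w :
  exists k, (renewal X n k w <= t < renewal X n k.+1 w)%N.
Proof.
have ex : exists k, (t < renewal X n k w)%N by exists t.+1; exact: renewal_ge.
have [[|k] tk mink] := ex_minnP ex; first by move: tk; rewrite (renewal0 hX).
exists k; rewrite tk andbT leqNgt; apply/negP => /mink.
by rewrite ltnn.
Qed.

Lemma measurable_frame_at n k :
  measurable_fun setT (frame_at X n k : Om -> frame R L).
Proof.
apply: (@measurability _ _ Om (frame R L) setT (frame_at X n k) (@frame_gen R L)) => //.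
move=> _ [F gF <-]; rewrite setTI.
(* Slicing by the value of the renewal slot turns the random time indices into constants. *)
have cover (Q : nat -> set Om) (E : set Om) : (forall s, measurable (Q s)) ->
    (forall w, E w <-> Q (renewal X n k w) w) -> measurable E.
  move=> mQ EQ; rewrite (_ : E = \bigcup_s ([set w | renewal X n k w = s] `&` Q s)).
    apply: bigcup_measurable => s _; apply: measurableI => //.
    exact: measurable_renewal_eq.
  apply/seteqP; split=> [w /EQ Qw|w [s _ [/= ws Qw]]].
    by exists (renewal X n k w).
  by apply/EQ; rewrite ws.
have mlt s j : measurable [set w | (j < renewal X n k.+1 w - s)%N].
  rewrite (_ : [set _ | _] = ~` [set w | (renewal X n k.+1 w <= s + j)%N]).
    apply: measurableC; apply: (hist_measurable hX (t := (s + j)%N)).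
    exact: (renewal_hist hX).
  apply/seteqP; split=> w /=; first by rewrite ltn_subRL ltnNge => /negP.
  by move/negP; rewrite -ltnNge ltn_subRL.
case: gF => [[[m ->]|[j [C [mC ->]]]]|[j [l [C [mC ->]]]]].
- apply: (cover (fun s => [set w | renewal X n k.+1 w = s + m]%N)) => [s|w].
    exact: measurable_renewal_eq.
  have := renewal_lt hX n k w; rewrite /preimage/=; lia.
- apply: (cover (fun s => [set w | (j < renewal X n k.+1 w - s)%N] `&`
    pen X n (s + j) @^-1` C)) => [s|w] //.
  apply: measurableI; first exact: mlt.
  rewrite -[X in measurable X]setTI.
  exact: (hist_fun_measurable (@pen_fun_hist n (s + j)%N)).
- apply: (cover (fun s => [set w | (j < renewal X n k.+1 w - s)%N] `&`
    (fun w => perf X n (s + j) w l) @^-1` C)) => [s|w] //.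
  apply: measurableI; first exact: mlt.
  rewrite -[X in measurable X]setTI.
  exact: (hist_fun_measurable (@perf_fun_hist n (s + j)%N l)).
Qed.

(** An event of [hist X s] cut by the event that the renewal occurs at [s] belongs to [hist_at n k]:
    its trace on [renewal X n k w <= t] is empty for [t < s] and the whole event otherwise. So the
    renewal property can be used with deterministic slots. *)
Lemma frame_cond n k s (E : set Om) (F : set (frame R L)) :
  hist X s E -> measurable F ->
  P (E `&` [set w | renewal X n k w = s] `&` frame_at X n k @^-1` F) =
  (\int[P]_(w in E `&` [set w | renewal X n k w = s]) law M n (act X n k w) F)%E.
Proof.
move=> hE mF.
have := @renewal_property _ _ _ _ _ _ _ _ hX n k
  (E `&` [set w | renewal X n k w = s]) setT F.
rewrite preimage_setT setIT; apply => // t; rewrite -setIA.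
have [st|ts] := leqP s t.
  rewrite (_ : _ `&` [set w | (_ <= t)%N] = [set w | renewal X n k w = s]).
    apply: (hist_le st); rewrite -hist_measurableE.
    by apply: measurableI; rewrite hist_measurableE//; exact: renewal_eq_hist.
  by apply/seteqP; split=> [w []//|w /= ws]; split; rewrite //= ws.
rewrite (_ : _ `&` _ = set0); first by rewrite -hist_measurableE.
apply/seteqP; split=> // w [_ [/= ->]]; lia.
Qed.

(** By the renewal property, the probability that the frame violates [Q] is the mean of
    [law M n (act X n k w)] of the violation, which is 0 whatever the action. *)
Lemma frame_ae n k (Q : frame R L -> Prop) :
  measurable ([set x | Q x] : set (frame R L)) ->
  (forall a : action M n, {ae law M n a, forall x, Q x}) ->
  {ae P, forall w, Q (frame_at X n k w)}.
Proof.
move=> mQ Qae.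
have mF : measurable (~` [set x | Q x] : set (frame R L)) by exact: measurableC.
exists (frame_at X n k @^-1` (~` [set x | Q x])); split => //.
  by rewrite -[X in measurable X]setTI; exact: measurable_frame_at.
have := @renewal_property _ _ _ _ _ _ _ _ hX n k setT setT (~` [set x | Q x]).
rewrite preimage_setT !setTI => ->//.
  under eq_integral => w _.
    rewrite (_ : law _ _ _ _ = 0%E); last first.
      have [A [mA A0 QA]] := Qae (act X n k w).
      by apply: (subset_measure0 _ _ _ A0) => // x; exact: QA.
    over.
  by rewrite integral0.
by move=> t; rewrite setTI; exact: (renewal_hist hX).
Qed.

End trajectory_facts.

(** * Frames along one path *)

Section paths.
Context (R : realType) (L : nat).
Variables (tau : nat -> nat) (T : nat).
Hypotheses (tau0 : tau 0%N = 0%N) (tau_lt : forall k, (tau k < tau k.+1)%N).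

Lemma tau_ge k : (k <= tau k)%N.
Proof. by elim: k => // k IHk; rewrite (leq_ltn_trans IHk). Qed.

(** [minn] cuts the frames at the horizon, and the indices [k < T] suffice because each frame lasts
    at least one slot. *)
Lemma sum_frames (G : nat -> R) :
  \sum_(t < T) G t =
  \sum_(k < T) \sum_(minn (tau k) T <= t < minn (tau k.+1) T) G t.
Proof.
have E m : \sum_(k < m) \sum_(minn (tau k) T <= t < minn (tau k.+1) T) G t =
    \sum_(0 <= t < minn (tau m) T) G t.
  elim: m => [|m IHm]; first by rewrite big_ord0 tau0 min0n big_geq.
  rewrite big_ord_recr/= IHm -big_cat_nat//.
  by have := tau_lt m; lia.
by rewrite E (minn_idPr (tau_ge T)) big_mkord.
Qed.

Lemma count_straddling :
  \sum_(k < T) ((tau k < T <= tau k.+1)%N)%:R <= 1 :> R.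
Proof.
(* Strengthened for the induction: the count stays 0 as long as [tau m] is below [T], and is at most
   1 afterwards. *)
have E m : (\sum_(k < m) (tau k < T <= tau k.+1) <= (T <= tau m))%N.
  elim: m => [|m IHm]; first by rewrite big_ord0.
  rewrite big_ord_recr/=; move: (tau_lt m) IHm; set S := (\sum_(_ < _) _)%N.
  by case: (ltnP (tau m) T); case: (leqP T (tau m.+1)) => /=; lia.
rewrite -natr_sum (le_trans (y := ((T <= tau T)%N : nat)%:R))// ?ler_nat//.
by case: leqP.
Qed.

Variables (r : nat -> R) (v W : nat -> 'I_L -> R) (rm vm wm c : R).
Hypotheses (c0 : 0 <= c) (wm0 : 0 <= wm) (rle : forall t, `|r t| <= rm)
  (vle : forall t l, `|v t l| <= vm) (Wle : forall t l, (t < T)%N -> `|W t l| <= wm)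
  (Wlip : forall s t l, (s <= t < T)%N -> `|W t l - W s l| <= c * (t - s)%N%:R).

(** Two replacements. Freezing the weights at [tau k] costs [L * c * vm * j] in the [j]-th slot,
    hence at most [L * c * vm / 2] times the squared length. Completing the truncated frame then
    costs at most [rm + L * wm * vm] for each slot from [T] on. *)
Lemma frame_path_le k : (tau k < T)%N ->
  \sum_(minn (tau k) T <= t < minn (tau k.+1) T) (r t + \sum_l W t l * v t l) <=
  \sum_(j < tau k.+1 - tau k)
     (r (tau k + j)%N + \sum_l W (tau k) l * v (tau k + j)%N l)
  + L%:R * (c * vm) / 2 * (tau k.+1 - tau k)%N%:R ^+ 2
  + (rm + L%:R * (wm * vm)) * (tau k.+1 - T)%N%:R.
Proof.
move=> kT; set m := tau k; set len := (tau k.+1 - m)%N.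
have mlt : (m < tau k.+1)%N by exact: tau_lt.
(* [p] counts the slots of the frame before the horizon; [H] is the slot value with frozen
   weights. *)
pose p := minn len (T - m).
pose H t := r t + \sum_l W m l * v t l.
have Hle t : `|H t| <= rm + L%:R * (wm * vm).
  rewrite (le_trans (ler_normD _ _))// lerD// (le_trans (ler_norm_sum _ _ _))//.
  rewrite (@le_trans _ _ (\sum_(l < L) wm * vm))//.
    by apply: ler_sum => l _; rewrite normrM ler_pM// Wle.
  by rewrite sumr_const card_ord mulr_natl.
have GH j : (m + j < T)%N ->
    r (m + j)%N + \sum_l W (m + j)%N l * v (m + j)%N l <=
    H (m + j)%N + L%:R * (c * vm) * j%:R.
  move=> jT; rewrite /H -addrA lerD2l -lerBlDl -sumrB.
  rewrite (@le_trans _ _ (\sum_(l < L) c * vm * j%:R))//.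
    apply: ler_sum => l _; rewrite -mulrBl (le_trans (ler_norm _))// normrM.
    rewrite mulrAC ler_pM//.
    by have := @Wlip m (m + j)%N l; rewrite leq_addr jT addKn; apply.
  by rewrite sumr_const card_ord mulr_natl mulrnAl.
rewrite (minn_idPl (ltnW kT)).
rewrite -[X in \sum_(X <= _ < _) _]addn0 -/m (_ : minn (tau k.+1) T = (p + m)%N); last first.
  by rewrite /p /len; lia.
rewrite addnC big_addn addnK.
rewrite (@le_trans _ _ (\sum_(0 <= j < p) (H (m + j)%N + L%:R * (c * vm) * j%:R)))//.
  apply: ler_sum_nat => j /andP[_ jp]; rewrite addnC GH//.
  by move: jp; rewrite /p; lia.
rewrite big_split/= -mulr_sumr.
have sumj q : \sum_(0 <= j < q) (j%:R : R) <= q%:R ^+ 2 / 2.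
  elim: q => [|q IHq]; first by rewrite big_geq// expr0n mul0r.
  by rewrite big_nat_recr//= -natr1; move: IHq; lra.
(* The sign of [vm] is known only through an index [l]; for [L = 0] the product vanishes. *)
have cvm : 0 <= L%:R * (c * vm).
  case: (posnP L) => [->|L0]; first by rewrite mul0r.
  by rewrite mulr_ge0// mulr_ge0// (le_trans _ (vle 0%N (Ordinal L0))).
have plen : (p <= len)%N by rewrite geq_minl.
have -> : (tau k.+1 - T = len - p)%N by rewrite /p /len; lia.
rewrite addrAC lerD//; last first.
  rewrite -[leRHS]mulrA ler_wpM2l// (le_trans (sumj p))// mulrC ler_wpM2l//.
  by rewrite lerXn2r ?nnegrE// ler_nat.
rewrite -(big_mkord xpredT (fun j => H (m + j)%N)).
rewrite [X in _ <= X + _](big_cat_nat (n := p))//=.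
rewrite -addrA lerDl addrC -[X in _ <= _ + X]opprK subr_ge0.
rewrite (le_trans (ler_norm _))// normrN (le_trans (ler_norm_sum _ _ _))//.
rewrite (@le_trans _ _ (\sum_(p <= j < len) (rm + L%:R * (wm * vm))))//.
  by apply: ler_sum_nat => j _; exact: Hle.
by rewrite sumr_const_nat mulr_natr.
Qed.

Lemma sum_path_le :
  \sum_(t < T) (r t + \sum_l W t l * v t l) <=
  \sum_(k < T | (tau k < T)%N) (\sum_(j < tau k.+1 - tau k)
     (r (tau k + j)%N + \sum_l W (tau k) l * v (tau k + j)%N l)
  + L%:R * (c * vm) / 2 * (tau k.+1 - tau k)%N%:R ^+ 2
  + (rm + L%:R * (wm * vm)) * (tau k.+1 - T)%N%:R).
Proof.
rewrite (sum_frames (fun t => r t + \sum_l W t l * v t l)).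
rewrite [leRHS]big_mkcond/=; apply: ler_sum => k _; case: ifPn => [/frame_path_le//|].
rewrite -leqNgt => Tk.
by rewrite big_geq//; have := tau_lt k; lia.
Qed.

End paths.

(** * Almost-sure slot bounds and conditioning at a renewal slot *)

Section frame_drift.
Context (R : realType) (N L : nat) (M : renewal_model R N L).
Variables (ymax zmax dmax B : R).
Hypotheses (hbounded : bounded_model M ymax zmax dmax) (hB : 1 <= B)
  (hresidual : residual_bound M B).
Context d (Om : measurableType d) (P : probability Om R) (X : trajectory M Om).
Hypothesis hX : admissible P X.
Implicit Types (n : 'I_N) (w : Om).

(** Every slot lies in some frame and there are countably many frames, so almost-sure bounds on
    frames pass to all slots at once. *)
Lemma slots_ae n (Q : nat -> frame R L -> Prop) (S : nat -> Om -> Prop) :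
  (forall j, measurable ([set x | (j < flen x)%N /\ ~ Q j x] : set (frame R L))) ->
  (forall a : action M n, {ae law M n a, forall x, forall j, (j < flen x)%N -> Q j x}) ->
  (forall k j w, Q j (frame_at X n k w) -> S (renewal X n k w + j)%N w) ->
  {ae P, forall w, forall t, S t w}.
Proof.
move=> mQ Qae QS.
have : {ae P, forall w, forall k, forall j,
    (j < flen (frame_at X n k w))%N -> Q j (frame_at X n k w)}.
  apply: ae_foralln => k.
  apply: (@frame_ae _ _ _ _ _ _ _ _ hX n k (fun x => forall j, (j < flen x)%N -> Q j x)) => //.
  rewrite (_ : [set x | _] = ~` (\bigcup_j [set x | (j < flen x)%N /\ ~ Q j x])).
    by apply: measurableC; exact: bigcup_measurable.
  apply/seteqP; split=> x /=; first by move=> Qx [j _ [jx]]; apply; exact: Qx.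
  move=> nQ j jx; apply: contrapT => nQj; apply: nQ; exists j => //.
apply: filterS => w Qw t.
have [k /andP[kt tk]] := renewal_cover hX n t w.
rewrite -(subnKC kt); apply: QS; apply: Qw; rewrite /frame_at/=.
by rewrite ltn_sub2r// (leq_ltn_trans kt).
Qed.

Lemma pen_ae n : {ae P, forall w, forall t, `|pen X n t w| <= ymax}.
Proof.
have [hy _ _] := hbounded.
apply: (slots_ae (Q := fun j x => `|fpen x j| <= ymax) _ (hy n)) => [j|//].
apply: sub_sigma_algebra; left; right; exists j, [set u | ~ (`|u| <= ymax)]; split => //.
rewrite (_ : [set u | _] = ~` ((fun u => `|u|) @^-1` `]-oo, ymax])).
  apply: measurableC; rewrite -[X in measurable X]setTI.
  exact: (normr_measurable measurableT).
by apply/seteqP; split=> u /=; rewrite in_itv.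
Qed.

Lemma perf_ae n : {ae P, forall w, forall t l, `|perf X n t w l| <= zmax}.
Proof.
have [_ hz _] := hbounded.
suff : {ae P, forall w, forall (l : 'I_L) t, `|perf X n t w l| <= zmax}.
  by apply: filterS => w h t l.
apply: filter_forall => l.
apply: (slots_ae (Q := fun j x => `|fperf x j l| <= zmax)) => [j|a|k j w]; last exact.
  apply: sub_sigma_algebra; right; exists j, l, [set u | ~ (`|u| <= zmax)]; split => //.
  rewrite (_ : [set u | _] = ~` ((fun u => `|u|) @^-1` `]-oo, zmax])).
    apply: measurableC; rewrite -[X in measurable X]setTI.
    exact: (normr_measurable measurableT).
  by apply/seteqP; split=> u /=; rewrite in_itv.
by apply: filterS (hz n a) => x zx j jx; exact: zx.
Qed.

Lemma ext_ae : {ae P, forall w, forall t l, `|tnth (ext X t w) l| <= dmax}.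
Proof.
have [_ _ [A [mA A0 dA]]] := hbounded; apply: ae_foralln => t.
exists (ext X t @^-1` A); split.
- rewrite -[X in measurable X]setTI.
  exact: (hist_fun_measurable hX (@ext_fun_hist _ _ _ _ _ _ _ _ hX t)).
- have := @ext_iid _ _ _ _ _ _ _ _ hX t setT A.
  rewrite setTI A0 mule0; apply => //.
  by rewrite -(hist_measurableE hX).
- by move=> w; exact: dA.
Qed.

Section weights.
Variables (s : nat) (W : Om -> R) (c : R).
Hypotheses (mW : measurable_fun setT (W : g_sigma_algebraType (hist X s) -> R))
  (W0 : forall w, 0 <= W w) (Wc : {ae P, forall w, W w <= c}).

Lemma frame_tower n k C (psi : frame R L -> R) :
  measurable_fun [set: frame R L] psi ->
  (forall a : action M n, (\int[law M n a]_x `|psi x|%:E <= C%:E)%E) ->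
  let A := [set w | renewal X n k w = s] in
  [/\ P.-integrable [set: Om] (EFin \o (fun w => \1_A w * (W w * psi (frame_at X n k w)))),
      P.-integrable [set: Om]
        (EFin \o (fun w => \1_A w * (W w * \int[law M n (act X n k w)]_x psi x)))
    & \int[P]_w (\1_A w * (W w * psi (frame_at X n k w))) =
      \int[P]_w (\1_A w * (W w * \int[law M n (act X n k w)]_x psi x))].
Proof.
move=> mpsi psiC A.
apply: (tower (hist_sigma_algebra hX s) (@hist_measurable _ _ _ _ _ _ _ _ hX s)
  (measurable_renewal_eq hX n k s) (measurable_frame_at hX n k)
  (kappa := fun w => law M n (act X n k w)) _ _ mW W0 Wc mpsi (C := C)) => //.
- move=> F mF; apply: (measurableT_comp (f := fun a => law M n a F)).
    exact: measurable_kernel.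
  exact: (act_measurable hX).
- by move=> E F; exact: frame_cond.
Qed.

(** [ext X s] is independent of [hist X s]: the tower property applies with the constant kernel
    [ext_law M] and the whole space as conditioning event. *)
Lemma ext_tower l :
  P.-integrable [set: Om] (EFin \o (fun w => W w * tnth (ext X s w) l)) /\
  \int[P]_w (W w * tnth (ext X s w) l) = dmean M l * \int[P]_w W w.
Proof.
have [_ _ hd] := hbounded.
have mW' : measurable_fun setT W.
  exact: (hist_fun_measurable hX mW).
have Wi : P.-integrable [set: Om] (EFin \o W).
  apply: (@ae_le_integrable _ _ _ _ _ (cst c)) => //.
    exact: finite_measure_integrable_cst.
  by apply: filterS Wc => w; rewrite ger0_norm.
have [|||i1 i2 e] := tower (hist_sigma_algebra hX s)
  (@hist_measurable _ _ _ _ _ _ _ _ hX s) measurableT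
  (hist_fun_measurable hX (@ext_fun_hist _ _ _ _ _ _ _ _ hX s))
  (kappa := fun _ => ext_law M) _ _ mW W0 Wc (measurable_tnth l) (C := dmax).
- by move=> F mF; exact: measurable_cst.
- move=> E F hE mF; rewrite setIT (ext_iid hX)//.
  rewrite integral_cst//; last exact: (hist_measurable hX hE).
  by rewrite muleC.
- move=> _; rewrite (@le_trans _ _ (\int[ext_law M]_v (cst dmax%:E) v))%E//.
    apply: ae_ge0_le_integral => //.
    + by apply/measurable_EFinP; apply: measurableT_comp => //; exact: measurable_tnth.
    + by move=> v _; rewrite lee_fin (dmax_ge0 hbounded l).
    + by apply: filterS hd => v dv _; rewrite lee_fin.
  rewrite integral_cst// [X in (_ * X)%E](_ : _ = 1%E) ?mule1//.
  exact: probability_setT.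
have E (f : Om -> R) : (fun w => \1_[set: Om] w * f w) = f.
  by apply/funext => w; rewrite indicT mul1r.
split; first by move: i1; rewrite E.
move: e; rewrite (E (fun w => W w * _)) (E (fun w => W w * _)) => ->.
by rewrite RintegralZr// mulrC.
Qed.

End weights.
End frame_drift.

(** * Drift over the frames of one system *)

Section frame_step.
Context (R : realType) (N L : nat) (M : renewal_model R N L).
Variables (ymax zmax dmax B : R).
Hypotheses (hbounded : bounded_model M ymax zmax dmax) (hB : 1 <= B)
  (hresidual : residual_bound M B).

Lemma flen_sqr_Rintegral (n : 'I_N) (a : action M n) :
  \int[law M n a]_w ((flen w)%:R ^+ 2) <= B.
Proof.
have le := flen_sqr_integral hresidual a.
have ge : (0 <= \int[law M n a]_w ((flen w)%:R ^+ 2)%:E)%E.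
  by apply: integral_ge0 => w _; rewrite lee_fin sqr_ge0.
rewrite -lee_fin /Rintegral fineK//.
by rewrite ge0_fin_numE// (le_lt_trans le)// ltry.
Qed.

Lemma flen_overshoot_Rintegral (n : 'I_N) (a : action M n) (s : nat) :
  \int[law M n a]_w ((flen w - s)%N%:R : R)
    <= B * \int[law M n a]_w (s <= flen w)%N%:R.
Proof.
have le := flen_overshoot_integral hresidual a s.
have mE : measurable ([set w | (s <= flen w)%N] : set (frame R L)).
  exact: measurable_flen_ge.
have -> : \int[law M n a]_w (s <= flen w)%N%:R =
    fine (law M n a [set w : frame R L | (s <= flen w)%N]).
  rewrite /Rintegral; congr fine.
  rewrite -[X in law M n a X]setIT -integral_indic//.
  apply: eq_integral => w _; rewrite indicE; congr ((nat_of_bool _)%:R%:E).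
  by apply/idP/idP => [h|/set_mem//]; exact/mem_set.
have ge : (0 <= \int[law M n a]_w ((flen w - s)%N%:R)%:E)%E.
  by apply: integral_ge0 => w _; rewrite lee_fin.
rewrite -lee_fin EFinM (fineK (law_fin a mE)) /Rintegral fineK//.
by rewrite ge0_fin_numE// (le_lt_trans le)// -(fineK (law_fin a mE)) -EFinM ltry.
Qed.

Context d (Om : measurableType d) (P : probability Om R) (X : trajectory M Om).
Hypothesis hX : admissible P X.
Variables (n : 'I_N) (T : nat) (a b : R) (e g : 'I_L -> R)
  (W : nat -> Om -> 'I_L -> R) (wm eps K1 K2 : R).
Hypotheses
  (mW : forall s l, measurable_fun setT
     ((fun w => W s w l) : g_sigma_algebraType (hist X s) -> R))
  (W0 : forall s w l, 0 <= W s w l)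
  (Wm : forall s l, (s < T)%N -> {ae P, forall w, W s w l <= wm})
  (K10 : 0 <= K1) (K20 : 0 <= K2) (eps0 : 0 <= eps).
Hypothesis opt : {ae P, forall w, forall k, (renewal X n k w < T)%N ->
  a + b * fhat (act X n k w) + \sum_l e l * ghat (act X n k w) l +
  \sum_l W (renewal X n k w) w l * (ghat (act X n k w) l - g l) <= eps}.

Definition dirac_coef (l l' : 'I_L) : R := (l' == l)%:R.

(** The weights are frozen at the slot [s] and kept outside the frame sums: each summand is then a
    weight known at [s] times a functional of the frame, the form that [frame_tower] handles. The
    inner frame reward sums [z_l - g l] over the frame. *)
Definition frame_value (s : nat) (x : frame R L) (w : Om) : R :=
  frame_reward a b e x +
  \sum_l W s w l * frame_reward (- g l) 0 (dirac_coef l) x.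

Definition frame_step_fun (k s : nat) (w : Om) : R :=
  \1_[set w | renewal X n k w = s] w *
  (frame_value s (frame_at X n k w) w + K1 * (flen (frame_at X n k w))%:R ^+ 2 +
   K2 * (flen (frame_at X n k w) - (T - s))%N%:R).

Definition straddle_fun (k s : nat) (w : Om) : R :=
  \1_[set w | renewal X n k w = s] w * (T - s <= flen (frame_at X n k w))%N%:R.

(** Once the frame is averaged given its action, its value becomes [That] times the rate bounded in
    [opt], hence at most [eps * B], and the quadratic term becomes at most [K1 * B]. The overshoot
    keeps the event [straddle_fun], to be summed over [k] later. *)
Lemma frame_step k s : (s < T)%N ->
  [/\ P.-integrable setT (EFin \o frame_step_fun k s),
      P.-integrable setT (EFin \o straddle_fun k s)
    & \int[P]_w frame_step_fun k s w <=
      (eps * B + K1 * B) * \int[P]_w \1_[set w | renewal X n k w = s] w +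
      K2 * B * \int[P]_w straddle_fun k s w].
Proof.
move=> sT; set A := [set w | _].
have B0 : 0 <= B by rewrite (le_trans _ hB).
have mA : measurable A by exact: (measurable_renewal_eq hX).
have m1 : measurable_fun setT ((cst 1) : g_sigma_algebraType (hist X s) -> R) by [].
have le1 : {ae P, forall w, (cst 1 : Om -> R) w <= 1} by exact: aeW.
have ge1 (w : Om) : 0 <= (cst 1 : Om -> R) w by [].
have [i0 j0 q0] := frame_tower hX m1 ge1 le1 (n := n) k (measurable_frame_reward a b e)
  (fun x : action M n => frame_reward_abs hbounded hresidual x a b e).
pose rl l := frame_reward (- g l) 0 (dirac_coef l) : frame R L -> R.
have tl l := frame_tower hX (@mW s l) (fun w => @W0 s w l) (@Wm s l sT) (n := n) k
  (measurable_frame_reward (- g l) 0 (dirac_coef l))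
  (fun x : action M n => frame_reward_abs hbounded hresidual x (- g l) 0 (dirac_coef l)).
have [||i2 j2 q2] := frame_tower hX m1 ge1 le1 (n := n) k
  (psi := fun x : frame R L => (flen x)%:R ^+ 2) (C := B).
- exact: (measurable_fun_flen (fun m => (m%:R : R) ^+ 2)).
- move=> x; under eq_integral do rewrite ger0_norm ?sqr_ge0//.
  exact: flen_sqr_integral.
have [||i3 j3 q3] := frame_tower hX m1 ge1 le1 (n := n) k
  (psi := fun x : frame R L => (flen x - (T - s))%N%:R) (C := B).
- exact: (measurable_fun_flen (fun m => (m - (T - s))%N%:R : R)).
- move=> x; apply: le_trans (flen_integral hresidual x).
  apply: ge0_le_integral => //.
  + apply/measurable_EFinP; apply: measurableT_comp => //.
    exact: (measurable_fun_flen (fun m => (m - (T - s))%N%:R : R)).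
  + by apply/measurable_EFinP; exact: measurable_flenR.
  + by move=> w _; rewrite lee_fin ger0_norm// ler_nat leq_subr.
have [||i4 j4 q4] := frame_tower hX m1 ge1 le1 (n := n) k
  (psi := fun x : frame R L => (T - s <= flen x)%N%:R) (C := 1).
- exact: (measurable_fun_flen (fun m => (T - s <= m)%N%:R : R)).
- move=> x; rewrite (@le_trans _ _ (\int[law M n x]_v (cst 1%:E) v))%E//.
    apply: ge0_le_integral => //.
    + apply/measurable_EFinP; apply: measurableT_comp => //.
      exact: (measurable_fun_flen (fun m => (T - s <= m)%N%:R : R)).
    + by move=> w _; rewrite lee_fin ger0_norm//; case: leqP.
  by rewrite integral_cst// law_setT mule1.
have SE : straddle_fun k s = fun w => \1_A w * (cst 1 w * (T - s <= flen (frame_at X n k w))%N%:R).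
  by apply/funext => w; rewrite mul1r.
have DE : frame_step_fun k s = fun w =>
   \1_A w * (cst 1 w * frame_reward a b e (frame_at X n k w)) +
   \sum_l \1_A w * (W s w l * rl l (frame_at X n k w)) +
   (K1 * (\1_A w * (cst 1 w * (flen (frame_at X n k w))%:R ^+ 2)) +
    K2 * (\1_A w * (cst 1 w * (flen (frame_at X n k w) - (T - s))%N%:R))).
  apply/funext => w; rewrite /frame_step_fun /frame_value -/A -mulr_sumr /=.
  by rewrite /rl; ring.
have il l := let: And3 h _ _ := tl l in h.
have jl l := let: And3 _ h _ := tl l in h.
have ql l := let: And3 _ _ h := tl l in h.
have is_ := integrable_sumr (index_enum 'I_L) (Q := xpredT) (fun l _ => il l).
have js_ := integrable_sumr (index_enum 'I_L) (Q := xpredT) (fun l _ => jl l).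
have i23 := integrable_addr (integrable_scaler K1 i2) (integrable_scaler K2 i3).
have j23 := integrable_addr (integrable_scaler K1 j2) (integrable_scaler K2 j3).
have iA : P.-integrable setT (EFin \o (\1_A : Om -> R)) by exact: integrable_indic.
split.
- by rewrite DE; apply: integrable_addr => //; exact: integrable_addr.
- by rewrite SE.
have -> : \int[P]_w frame_step_fun k s w = \int[P]_w (
   \1_A w * (cst 1 w * \int[law M n (act X n k w)]_x frame_reward a b e x) +
   \sum_l \1_A w * (W s w l * \int[law M n (act X n k w)]_x rl l x) +
   (K1 * (\1_A w * (cst 1 w * \int[law M n (act X n k w)]_x (flen x)%:R ^+ 2)) +
    K2 * (\1_A w * (cst 1 w *
      \int[law M n (act X n k w)]_x (flen x - (T - s))%N%:R)))).
  rewrite DE !RintegralD//;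
    try exact: integrable_addr; try exact: integrable_scaler.
  rewrite !RintegralZl// q0 q2 q3 !Rintegral_sum//.
  by rewrite [X in _ + X + _](eq_bigr _ (fun l _ => ql l)).
rewrite SE q4 -!RintegralZl// -RintegralD//; try exact: integrable_scaler.
apply: ae_le_Rintegral => //.
- by apply: integrable_addr => //; exact: integrable_addr.
- by apply: integrable_addr; exact: integrable_scaler.
apply: filterS opt => w optw.
have [wA|wA] := pselect (A w); last first.
  rewrite indicE memNset// !mul0r !mulr0 !addr0 add0r big1// => l _.
  by rewrite mul0r.
rewrite indicE mem_set// !mul1r /=.
set x := act X n k w.
have xT : (renewal X n k w < T)%N by rewrite wA.
have T0 : 0 <= That x by rewrite (le_trans _ (That_ge1 hresidual x)).
rewrite (frame_reward_integral hbounded hresidual).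
have -> : \sum_l true%:R * (W s w l * \int[law M n x]_v rl l v) =
    That x * \sum_l W s w l * (ghat x l - g l).
  rewrite mulr_sumr; apply: eq_bigr => l _; rewrite mul1r /rl.
  rewrite (frame_reward_integral hbounded hresidual) mul0r addr0.
  rewrite (bigD1 l)//= /dirac_coef eqxx mul1r big1 ?addr0; first by ring.
  by move=> i /negbTE ->; rewrite mul0r.
rewrite -mulrDr mulr1 -[leRHS]addrA lerD//.
  have := optw k xT; rewrite wA -/x => /(ler_wpM2l T0) /le_trans; apply.
  by rewrite mulrC ler_wpM2l// That_le.
rewrite lerD//; first by rewrite ler_wpM2l// flen_sqr_Rintegral.
by rewrite -mulrA ler_wpM2l// flen_overshoot_Rintegral.
Qed.

End frame_step.

Section frame_drift.
Context (R : realType) (N L : nat) (M : renewal_model R N L).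
Variables (ymax zmax dmax B : R).
Hypotheses (hbounded : bounded_model M ymax zmax dmax) (hB : 1 <= B)
  (hresidual : residual_bound M B).
Context d (Om : measurableType d) (P : probability Om R) (X : trajectory M Om).
Hypothesis hX : admissible P X.
Variables (n : 'I_N) (T : nat) (a b : R) (e g : 'I_L -> R)
  (W : nat -> Om -> 'I_L -> R) (wm c eps : R).
Hypotheses
  (mW : forall s l, measurable_fun setT
     ((fun w => W s w l) : g_sigma_algebraType (hist X s) -> R))
  (W0 : forall s w l, 0 <= W s w l)
  (Wm : {ae P, forall w, forall s l, (s < T)%N -> W s w l <= wm})
  (Wlip : {ae P, forall w, forall s t l, (s <= t < T)%N ->
     `|W t w l - W s w l| <= c * (t - s)%N%:R})
  (gz : forall l, `|g l| <= zmax)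
  (wm0 : 0 <= wm) (c0 : 0 <= c) (eps0 : 0 <= eps).
Hypothesis opt : {ae P, forall w, forall k, (renewal X n k w < T)%N ->
  a + b * fhat (act X n k w) + \sum_l e l * ghat (act X n k w) l +
  \sum_l W (renewal X n k w) w l * (ghat (act X n k w) l - g l) <= eps}.

(** Serves twice: with [W] the queues, for the drift under the algorithm, and with [W = 0], for the
    averages of an arbitrary admissible trajectory. *)
Definition weighted_slot (t : nat) (w : Om) : R :=
  slot_reward a b e (pen X n t w) (perf X n t w) +
  \sum_l W t w l * (perf X n t w l - g l).

(** [2 * zmax] bounds [z_l - g l]. [K1] pays for freezing the weights during a frame, [K2] for one
    slot past the horizon. *)
Let K1 := L%:R * (c * (2 * zmax)) / 2.
Let K2 := reward_max ymax zmax a b e + L%:R * (wm * (2 * zmax)).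

Lemma sum_renewal_indic (F : nat -> R) k w :
  \sum_(s < T) \1_[set w | renewal X n k w = s] w * F s =
  if (renewal X n k w < T)%N then F (renewal X n k w) else 0.
Proof.
case: ifPn => [kT|kT].
  rewrite (bigD1 (Ordinal kT))//= indicE mem_set// mul1r big1 ?addr0// => s /eqP sk.
  rewrite indicE memNset ?mul0r//= => ks; apply: sk.
  by apply/val_inj; rewrite /= -ks.
rewrite big1// => s _; rewrite indicE memNset ?mul0r//= => ks.
by move: kT; rewrite ks ltn_ord.
Qed.

Lemma weighted_slot_integrable t : (t < T)%N ->
  P.-integrable setT (EFin \o weighted_slot t).
Proof.
move=> tT.
apply: (@ae_le_integrable _ _ _ _ _ (cst K2)).
- apply: measurable_funD; first apply: measurable_funD; first apply: measurable_funD => //.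
  + apply: measurable_funM => //.
    exact: (hist_fun_measurable hX (@pen_fun_hist _ _ _ _ _ _ _ _ hX n t)).
  + apply: measurable_sum => l; apply: measurable_funM => //.
    exact: (hist_fun_measurable hX (@perf_fun_hist _ _ _ _ _ _ _ _ hX n t l)).
  + apply: measurable_sum => l; apply: measurable_funM => //.
      exact: (hist_fun_measurable hX (@mW t l)).
    apply: measurable_funB => //.
    exact: (hist_fun_measurable hX (@perf_fun_hist _ _ _ _ _ _ _ _ hX n t l)).
- exact: finite_measure_integrable_cst.
apply: filterS3 (pen_ae hbounded hX n) (perf_ae hbounded hX n) Wm => w yw zw Ww.
rewrite (le_trans (ler_normD _ _))// lerD//; first exact: slot_reward_le.
rewrite (le_trans (ler_norm_sum _ _ _))//.
rewrite (@le_trans _ _ (\sum_(l < L) wm * (2 * zmax)))//.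
  apply: ler_sum => l _; rewrite normrM ler_pM//.
    by rewrite ger0_norm ?W0// Ww.
  by rewrite (le_trans (ler_normB _ _))// mulrDl mul1r lerD.
by rewrite sumr_const card_ord [leRHS]mulr_natl.
Qed.

Lemma weighted_slot_path : {ae P, forall w, \sum_(t < T) weighted_slot t w <=
  \sum_(k < T) \sum_(s < T) frame_step_fun X n T a b e g W K1 K2 k s w}.
Proof.
apply: filterS2 (filterI (pen_ae hbounded hX n) (perf_ae hbounded hX n))
  (filterI Wm Wlip) => w [yw zw] [Ww Wl].
have := @sum_path_le R L (fun k => renewal X n k w) T (renewal0 hX n w)
  (fun k => @renewal_lt _ _ _ _ _ _ _ _ hX n k w)
  (fun t => slot_reward a b e (pen X n t w) (perf X n t w))
  (fun t l => perf X n t w l - g l) (fun t => W t w)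
  (reward_max ymax zmax a b e) (2 * zmax) wm c c0 wm0.
move=> /(_ (fun t => slot_reward_le _ _ _ (yw t) (zw t))).
have vle t l : `|perf X n t w l - g l| <= 2 * zmax.
  by rewrite (le_trans (ler_normB _ _))// mulrDl mul1r lerD.
move=> /(_ vle); have Wle t l : (t < T)%N -> `|W t w l| <= wm.
  by move=> tT; rewrite ger0_norm ?W0// Ww.
move=> /(_ Wle Wl) /le_trans; apply.
rewrite big_mkcond/=; apply: ler_sum => k _.
pose F s := frame_value a b e g W s (frame_at X n k w) w +
  K1 * (flen (frame_at X n k w))%:R ^+ 2 + K2 * (flen (frame_at X n k w) - (T - s))%N%:R.
rewrite -[leRHS]/(\sum_(s < T) \1_[set w | renewal X n k w = s] w * F s).
rewrite sum_renewal_indic; case: ifPn => // kT; rewrite /F.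
set s := renewal X n k w.
(* The overshoot past the horizon, seen from the start [s] of the frame. *)
have -> : (flen (frame_at X n k w) - (T - s) = renewal X n k.+1 w - T)%N.
  by have := @renewal_lt _ _ _ _ _ _ _ _ hX n k w; rewrite /= -/s; move: kT; rewrite -/s; lia.
rewrite le_eqVlt; apply/orP; left; apply/eqP; congr (_ + _ + _).
rewrite big_split/=; congr (_ + _).
rewrite exchange_big/=; apply: eq_bigr => l _; rewrite -mulr_sumr; congr (_ * _).
apply: eq_bigr => j _; rewrite /slot_reward mul0r addr0 (bigD1 l)//= /dirac_coef eqxx mul1r.
by rewrite big1 ?addr0 1?addrC// => i /negbTE ->; rewrite mul0r.
Qed.

(** Sums [frame_step] over [k < T] and [s < T]: the starts contribute a factor [T], the straddling
    events a factor 1. *)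
Lemma frame_drift :
  \sum_(t < T) \int[P]_w weighted_slot t w <=
  T%:R * (eps * B + K1 * B) + K2 * B.
Proof.
have B0 : 0 <= B by rewrite (le_trans _ hB).
(* Any action gives access to the signs of [ymax] and [zmax]. *)
have x : action M n := act X n 0%N point.
have z0 (l : 'I_L) : 0 <= zmax := zmax_ge0 hbounded x l.
have Lz u : 0 <= u -> 0 <= L%:R * (u * (2 * zmax)) :> R.
  move=> u0; case: (posnP L) => [->|L0]; first by rewrite mul0r.
  by rewrite mulr_ge0// mulr_ge0// mulr_ge0// (z0 (Ordinal L0)).
have K10 : 0 <= K1 by rewrite /K1 mulr_ge0// Lz.
have K20 : 0 <= K2 by rewrite /K2 addr_ge0// ?Lz// (reward_max_ge0 hbounded x).
have Wm' s l : (s < T)%N -> {ae P, forall w, W s w l <= wm}.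
  by move=> sT; apply: filterS Wm => w h; exact: h.
have step k (s : 'I_T) := frame_step hbounded hB hresidual hX mW W0 Wm' K10 K20 eps0
  opt k (ltn_ord s).
have i1 k s := let: And3 h _ _ := step k s in h.
have i2 k s := let: And3 _ h _ := step k s in h.
have le3 k s := let: And3 _ _ h := step k s in h.
have ii k := integrable_sumr (index_enum 'I_T) (Q := xpredT) (fun s _ => i1 k s).
have is2 k := integrable_sumr (index_enum 'I_T) (Q := xpredT) (fun s _ => i2 k s).
rewrite -Rintegral_sum; last by move=> t; exact: weighted_slot_integrable.
apply: le_trans (ae_le_Rintegral _ _ weighted_slot_path) _.
- by apply: integrable_sumr => t _; exact: weighted_slot_integrable.
- by apply: integrable_sumr => k _.
have iA k (s : 'I_T) : P.-integrable setT
    (EFin \o (\1_[set w | renewal X n k w = s] : Om -> R)).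
  by apply: integrable_indic => //; exact: (measurable_renewal_eq hX).
have iAs k := integrable_sumr (index_enum 'I_T) (Q := xpredT) (fun s _ => iA k s).
rewrite Rintegral_sum//.
under eq_bigr do rewrite Rintegral_sum//.
apply: (@le_trans _ _ (\sum_(k < T) \sum_(s < T)
   ((eps * B + K1 * B) * \int[P]_w \1_[set w | renewal X n k w = s] w +
    K2 * B * \int[P]_w straddle_fun X n T k s w))).
  by apply: ler_sum => k _; apply: ler_sum => s _; exact: le3.
under eq_bigr do rewrite big_split/= -!mulr_sumr -!Rintegral_sum//.
(* For each [k < T] at most one slot [s < T] is the start of the frame, whence at most [T]
   starts. *)
rewrite big_split/= -!mulr_sumr -!Rintegral_sum// lerD//.
  rewrite mulrC ler_wpM2r//; first by rewrite addr_ge0// mulr_ge0.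
  apply: (@le_trans _ _ (\int[P]_w (cst T%:R w))); last first.
    by rewrite Rintegral_cst_prob.
  apply: le_Rintegral => //.
  - exact: integrable_sumr.
  - exact: finite_measure_integrable_cst.
  move=> w _; rewrite -[leRHS]mulr1 -[in leRHS](card_ord T) mulr_natl -sumr_const.
  apply: ler_sum => k _.
  rewrite (eq_bigr (fun s : 'I_T => \1_[set w | renewal X n k w = s] w * (fun=> 1) (s : nat))).
    by rewrite (sum_renewal_indic (fun=> 1)); case: ifP.
  by move=> s _; rewrite mulr1.
(* At most one frame straddles the horizon on each path, so the straddling probabilities sum to at
   most 1. *)
rewrite -[leRHS]mulr1 ler_wpM2l ?mulr_ge0//.
apply: (@le_trans _ _ (\int[P]_w (cst 1 w))); last first.
  by rewrite Rintegral_cst_prob.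
apply: le_Rintegral => //.
- exact: integrable_sumr.
- exact: finite_measure_integrable_cst.
move=> w _; apply: le_trans (@count_straddling R (fun k => renewal X n k w) T
  (renewal0 hX n w) (fun k => @renewal_lt _ _ _ _ _ _ _ _ hX n k w)).
apply: ler_sum => k _.
rewrite (sum_renewal_indic (fun s => (T - s <= flen (frame_at X n k w))%N%:R)).
case: ifPn => // kT; rewrite ler_nat /=; have := @renewal_lt _ _ _ _ _ _ _ _ hX n k w; lia.
Qed.

End frame_drift.

(** * Time averages of an arbitrary trajectory *)

Section limsup.
Context (R : realType).
Implicit Types (u : nat -> \bar R) (x : \bar R).
Local Open Scope ereal_scope.

Lemma limn_esup_lt u x : limn_esup u < x -> \forall n \near \oo, u n < x.
Proof.
rewrite /limn_esup limf_esupE => /ereal_inf_lt[_ [A nA <-]] supx.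
apply: filterS nA => n An; apply: le_lt_trans supx.
by apply: ereal_sup_ubound; exists n.
Qed.

Lemma limn_esup_le u x : (\forall n \near \oo, u n <= x) -> limn_esup u <= x.
Proof.
move=> ux; rewrite /limn_esup limf_esupE.
apply: (@le_trans _ _ (ereal_sup (u @` [set n | u n <= x]))).
  by apply: ereal_inf_lbound; exists [set n | u n <= x].
by apply: ge_ereal_sup => _ [n un <-].
Qed.

(** Testing reals strictly above [y] also covers an infinite [y]; a strict bound on a limsup is what
    yields a bound on the averages themselves. *)
Lemma lee_real_gt (x y : \bar R) : (forall r : R, y < r%:E -> x <= r%:E) -> x <= y.
Proof.
case: y => [y| |] xy.
- by apply/lee_addgt0Pr => e e0; apply: xy; rewrite lte_fin ltrDl.
- exact: leey.
- case: x xy => [x| |] xy //.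
  + by have := xy (x - 1)%R (ltNyr _); rewrite lee_fin => h; exfalso; lra.
  + by have := xy 0%R (ltNyr _); rewrite leye_eq.
Qed.

End limsup.

Section averages.
Context (R : realType) (N L : nat) (M : renewal_model R N L).
Variables (ymax zmax dmax B : R).
Hypotheses (hbounded : bounded_model M ymax zmax dmax) (hB : 1 <= B)
  (hresidual : residual_bound M B).
Context d (Om : measurableType d) (P : probability Om R) (X : trajectory M Om).
Hypothesis hX : admissible P X.
Implicit Types (n : 'I_N) (t T : nat) (l : 'I_L).

Lemma pen_integrable n t : P.-integrable setT (EFin \o pen X n t).
Proof.
apply: (@ae_le_integrable _ _ _ _ _ (cst ymax)).
- exact: (hist_fun_measurable hX (@pen_fun_hist _ _ _ _ _ _ _ _ hX n t)).
- exact: finite_measure_integrable_cst.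
by apply: filterS (pen_ae hbounded hX n) => w; exact.
Qed.

Lemma perf_integrable n t l :
  P.-integrable setT (EFin \o (fun w => perf X n t w l)).
Proof.
apply: (@ae_le_integrable _ _ _ _ _ (cst zmax)).
- exact: (hist_fun_measurable hX (@perf_fun_hist _ _ _ _ _ _ _ _ hX n t l)).
- exact: finite_measure_integrable_cst.
by apply: filterS (perf_ae hbounded hX n) => w; exact.
Qed.

Lemma ae_normr_Rintegral_le (f : Om -> R) (r : R) :
  P.-integrable setT (EFin \o f) -> {ae P, forall w, `|f w| <= r} ->
  `|\int[P]_w f w| <= r.
Proof.
move=> fi fr; rewrite (le_trans (le_normr_Rintegral measurableT fi))//.
rewrite -(Rintegral_cst_prob P r); apply: ae_le_Rintegral => //.
- exact: (integrable_norm fi).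
- exact: finite_measure_integrable_cst.
Qed.

Definition pen_mean n t := \int[P]_w pen X n t w.
Definition perf_mean n t l := \int[P]_w perf X n t w l.

Lemma pen_mean_le n t : `|pen_mean n t| <= ymax.
Proof.
apply: ae_normr_Rintegral_le; first exact: pen_integrable.
by apply: filterS (pen_ae hbounded hX n) => w; exact.
Qed.

Lemma perf_mean_le n t l : `|perf_mean n t l| <= zmax.
Proof.
apply: ae_normr_Rintegral_le; first exact: perf_integrable.
by apply: filterS (perf_ae hbounded hX n) => w; exact.
Qed.

Lemma penalty_averageE T :
  ((T%:R^-1)%:E * \sum_(t < T) \sum_(n < N) 'E_P[pen X n t])%E =
  (T%:R^-1 * \sum_(t < T) \sum_(n < N) pen_mean n t)%:E.
Proof.
rewrite EFinM -sumEFin; congr (_ * _)%E; apply: eq_bigr => t _.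
rewrite -sumEFin; apply: eq_bigr => n _; rewrite unlock /pen_mean /Rintegral fineK//.
exact: (integrable_fin_num measurableT (pen_integrable n t)).
Qed.

Lemma performance_averageE T l :
  ((T%:R^-1)%:E * \sum_(t < T) \sum_(n < N) 'E_P[fun w => perf X n t w l])%E =
  (T%:R^-1 * \sum_(t < T) \sum_(n < N) perf_mean n t l)%:E.
Proof.
rewrite EFinM -sumEFin; congr (_ * _)%E; apply: eq_bigr => t _.
rewrite -sumEFin; apply: eq_bigr => n _; rewrite unlock /perf_mean /Rintegral fineK//.
exact: (integrable_fin_num measurableT (perf_integrable n t l)).
Qed.

Lemma average_le (u : nat -> R) (r : R) T : (forall t, `|u t| <= r) -> 0 <= r ->
  `|T%:R^-1 * \sum_(t < T) u t| <= r.
Proof.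
move=> ur r0; have [->|T0] := posnP T; first by rewrite big_ord0 mulr0 normr0.
rewrite normrM ger0_norm ?invr_ge0// ler_pdivrMl ?ltr0n//.
rewrite (le_trans (ler_norm_sum _ _ _))// (@le_trans _ _ (\sum_(t < T) r))//.
  exact: ler_sum.
by rewrite sumr_const card_ord [leRHS]mulr_natl.
Qed.

Lemma value_le n (x : action M n) a b e :
  `|a + b * fhat x + \sum_l e l * ghat x l| <= reward_max ymax zmax a b e.
Proof.
have T0 : 0 < That x by rewrite (lt_le_trans _ (That_ge1 hresidual x)).
have := frame_reward_integral hbounded hresidual x a b e.
move=> /(congr1 Num.norm); rewrite normrM (gtr0_norm T0) => E.
rewrite -(ler_pM2l T0) -E.
have fi := frame_reward_integrable hbounded hresidual x a b e.
apply: le_trans (le_normr_Rintegral measurableT fi) _.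
rewrite mulrC -RintegralZl//; last exact: (flen_integrable hresidual x).
apply: ae_le_Rintegral.
- exact: (integrable_norm fi).
- by apply: integrable_scaler; exact: (flen_integrable hresidual x).
- exact: (frame_reward_le hbounded).
Qed.

(** [frame_drift] with zero queue weights and slot reward [m - V y - <q, z>]. By the choice of [m]
    no action has a positive rate, and no weight is frozen since [q] is constant, so the only error
    is the overshoot of the straddling frame, divided by [T]. *)
Lemma average_ge_min n (T : nat) (V m : R) (q : 'I_L -> R) : (0 < T)%N ->
  (forall x : action M n, m <= V * fhat x + \sum_l q l * ghat x l) ->
  m <= V * (T%:R^-1 * \sum_(t < T) pen_mean n t) +
       \sum_l q l * (T%:R^-1 * \sum_(t < T) perf_mean n t l) +
       reward_max ymax zmax m (- V) (fun l => - q l) * B / T%:R.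
Proof.
move=> T0 mmin.
have x : action M n := act X n 0%N point.
have := @frame_drift R N L M ymax zmax dmax B hbounded hB hresidual _ _ P X hX n T
  m (- V) (fun l => - q l) (fun=> 0) (fun _ _ _ => 0) 0 0 0.
have m0 s (l : 'I_L) : measurable_fun setT
    ((fun=> 0) : g_sigma_algebraType (hist X s) -> R) by [].
move=> /(_ m0 (fun _ _ _ => lexx 0)).
move=> /(_ (aeW _ (fun w s l _ => lexx 0))).
have lip : {ae P, forall w : Om, forall s t (l : 'I_L), (s <= t < T)%N ->
    `|0 - 0 : R| <= 0 * (t - s)%N%:R}.
  by apply: aeW => w s t l _; rewrite subrr normr0 mul0r.
move=> /(_ lip).
have z0 (l : 'I_L) : `|0 : R| <= zmax by rewrite normr0 (zmax_ge0 hbounded x).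
move=> /(_ z0 (lexx 0) (lexx 0) (lexx 0)).
have opt : {ae P, forall w, forall k, (renewal X n k w < T)%N ->
   m + - V * fhat (act X n k w) + \sum_l - q l * ghat (act X n k w) l +
   \sum_(l < L) 0 * (ghat (act X n k w) l - 0) <= 0}.
  apply: aeW => w k _; rewrite [X in _ + X]big1 ?addr0; last by move=> l _; rewrite mul0r.
  rewrite (eq_bigr (fun l => - (q l * ghat (act X n k w) l))); last first.
    by move=> l _; rewrite mulNr.
  by rewrite sumrN mulNr -addrA -opprD subr_le0.
move=> /(_ opt).
rewrite !mul0r !mulr0 !mul0r !addr0 mulr0 add0r => le.
have E t : \int[P]_w weighted_slot X n m (- V) (fun l => - q l) (fun=> 0)
    (fun _ _ _ => 0) t w = m - V * pen_mean n t - \sum_l q l * perf_mean n t l.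
  rewrite (_ : weighted_slot _ _ _ _ _ _ _ _ = fun w =>
      m - V * pen X n t w - \sum_l q l * perf X n t w l); last first.
    apply/funext => w; rewrite /weighted_slot /slot_reward.
    rewrite [X in _ + X]big1 ?addr0; last by move=> l _; rewrite mul0r.
    by rewrite mulNr -sumrN; congr (_ + _); apply: eq_bigr => l _; rewrite mulNr.
  have ip := integrable_scaler V (pen_integrable n t).
  have ic : P.-integrable setT (EFin \o (cst m : Om -> R)).
    exact: finite_measure_integrable_cst.
  have iz l := integrable_scaler (q l) (perf_integrable n t l).
  rewrite RintegralB//; last 2 first.
  - exact: integrable_subr.
  - exact: integrable_sumr.
  rewrite RintegralB// Rintegral_cst_prob Rintegral_sum// RintegralZl//; last first.
    exact: pen_integrable.
  congr (_ - _); apply: eq_bigr => l _; rewrite RintegralZl//.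
  exact: perf_integrable.
move: le; under eq_bigr do rewrite E.
rewrite !big_split/= sumr_const card_ord !sumrN -mulr_sumr exchange_big/=.
under [X in _ - X]eq_bigr do rewrite -mulr_sumr.
move=> le; have T0' : 0 < T%:R :> R by rewrite ltr0n.
rewrite -(ler_pM2l T0') !mulrDr mulrCA (mulrA T%:R T%:R^-1) divff ?gt_eqF// mul1r.
rewrite [in leRHS](mulrC _ (_ / _)) divfK ?gt_eqF//.
have -> : T%:R * (\sum_l q l * (T%:R^-1 * \sum_(t < T) perf_mean n t l)) =
    \sum_l q l * \sum_(t < T) perf_mean n t l.
  rewrite mulr_sumr; apply: eq_bigr => l _.
  by rewrite mulrCA (mulrA T%:R) divff ?gt_eqF// mul1r.
move: le; rewrite -[m *+ T]mulr_natl => le; clear -le; lra.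
Qed.

End averages.

(** * Comparison pairs from a feasible trajectory *)

Section reference.
Context (R : realType) (N L : nat) (M : renewal_model R N L).
Variables (ymax zmax dmax B : R).
Hypotheses (hbounded : bounded_model M ymax zmax dmax) (hB : 1 <= B)
  (hresidual : residual_bound M B).
Context d (Om : measurableType d) (P : probability Om R) (X : trajectory M Om).
Hypothesis hX : admissible P X.

(** [qmax] is given before the averaging horizon is chosen, so a single pair serves every weight in
    the box. The strict bound by [r] makes the averaged penalty drop below [r] eventually, whereas
    the constraints are met only up to [eps]. *)
Lemma reference_exists (V qmax r eps : R) : 0 <= V -> 0 <= qmax -> 0 < eps ->
  satisfies_constraints P X -> (penalty_cost P X < r%:E)%E ->
  exists (f : 'I_N -> R) (g : 'I_N -> 'I_L -> R),
  [/\ \sum_n f n <= r, forall l, \sum_n g n l <= dmean M l + eps,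
      forall n, `|f n| <= ymax, forall n l, `|g n l| <= zmax
    & forall n (x : action M n) (q : 'I_L -> R), (forall l, 0 <= q l <= qmax) ->
      (forall x' : action M n, V * fhat x + \sum_l q l * ghat x l <=
                               V * fhat x' + \sum_l q l * ghat x' l) ->
      V * fhat x + \sum_l q l * ghat x l <=
      V * f n + \sum_l q l * g n l + eps].
Proof.
move=> V0 q0 eps0 hcon hpen.
(* Bounds the [reward_max] of [average_ge_min]: one half for the minimal value [m], the other for
   the slot reward. *)
pose K := (V * ymax + L%:R * (qmax * zmax)) *+ 2.
have pen_near : \forall T \near \oo,
    T%:R^-1 * \sum_(t < T) \sum_(n < N) pen_mean P X n t < r.
  have := limn_esup_lt hpen; apply: filterS => T.
  by rewrite (penalty_averageE hbounded hX) lte_fin.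
have perf_near : \forall T \near \oo, forall l : 'I_L,
    T%:R^-1 * \sum_(t < T) \sum_(n < N) perf_mean P X n t l < dmean M l + eps.
  apply: filter_forall => l.
  have /limn_esup_lt : (performance_cost P X l < (dmean M l + eps)%:E)%E.
    by rewrite (le_lt_trans (hcon l))// lte_fin ltrDl.
  by apply: filterS => T; rewrite (performance_averageE hbounded hX) lte_fin.
have /filter_ex[T [[penT perfT] [T0 TK]]] : \forall T \near \oo,
    ((T%:R^-1 * \sum_(t < T) \sum_(n < N) pen_mean P X n t < r) /\
     (forall l : 'I_L, T%:R^-1 * \sum_(t < T) \sum_(n < N) perf_mean P X n t l <
       dmean M l + eps)) /\
    ((0 < T)%N /\ K * B / eps <= T%:R).
  apply: filterI; first exact: filterI.
  by apply: filterI; [exact: nbhs_infty_gt|exact: nbhs_infty_ger].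
have T0' : 0 < T%:R :> R by rewrite ltr0n.
exists (fun n => T%:R^-1 * \sum_(t < T) pen_mean P X n t).
exists (fun n l => T%:R^-1 * \sum_(t < T) perf_mean P X n t l).
split.
- by rewrite -mulr_sumr exchange_big/= ltW.
- by move=> l; rewrite -mulr_sumr exchange_big/= ltW.
- move=> n; apply: average_le; first by move=> t; exact: (pen_mean_le hbounded hX).
  exact: (ymax_ge0 hbounded (act X n 0%N point)).
- move=> n l; apply: (average_le (u := fun t => perf_mean P X n t l)).
    by move=> t; exact: (perf_mean_le hbounded hX).
  exact: (zmax_ge0 hbounded (act X n 0%N point) l).
move=> n x q qle xmin.
apply: le_trans (average_ge_min hbounded hB hresidual hX T0 xmin) _.
rewrite lerD2l ler_pdivrMr//.
have B0 : 0 < B by rewrite (lt_le_trans _ hB).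
move: TK; rewrite ler_pdivrMr// (mulrC T%:R) => /(le_trans _); apply.
apply: ler_wpM2r; first exact: ltW.
have Q : \sum_l `|q l| * zmax <= L%:R * (qmax * zmax).
  apply: (@le_trans _ _ (\sum_(l < L) qmax * zmax)); last first.
    by rewrite sumr_const card_ord [leRHS]mulr_natl.
  apply: ler_sum => l _; have /andP[ql0 ql] := qle l.
  by rewrite ler_wpM2r ?(zmax_ge0 hbounded x)// ger0_norm.
have := value_le hbounded hresidual x 0 V q.
rewrite add0r /reward_max normr0 add0r normrN (ger0_norm V0) => le.
rewrite [X in _ + _ + X](eq_bigr (fun l => `|q l| * zmax)); last first.
  by move=> l _; rewrite normrN.
rewrite /K mulr2n -addrA.
by apply: lerD; [apply: le_trans le _|]; rewrite lerD2l.
Qed.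

End reference.

(** * The virtual queues *)

Section queue_paths.
Context (R : realType) (N L : nat) (M : renewal_model R N L).
Context d (Om : measurableType d) (X : trajectory M Om).

Definition queue_increment (t : nat) (w : Om) (l : 'I_L) : R :=
  \sum_n perf X n t w l - tnth (ext X t w) l.

Lemma queueS t w l :
  queue X t.+1 w l = Num.max (queue X t w l + queue_increment t w l) 0.
Proof. by rewrite /= /queue_increment addrA. Qed.

Lemma queue_ge0 t w l : 0 <= queue X t w l.
Proof. by case: t => // t; rewrite queueS le_max lexx orbT. Qed.

Lemma sum_increment_le t w l :
  \sum_(s < t) queue_increment s w l <= queue X t w l.
Proof.
elim: t => [|t IHt]; first by rewrite big_ord0.
by rewrite big_ord_recr/= -/(queue X t.+1 w l) queueS le_max lerD2r IHt.
Qed.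

Variables (c : R) (w : Om).
Hypothesis incr_le : forall t l, `|queue_increment t w l| <= c.

Lemma queue_lip s t l : (s <= t)%N ->
  `|queue X t w l - queue X s w l| <= c * (t - s)%N%:R.
Proof.
move=> /subnK <-; rewrite addnK.
elim: (t - s)%N => [|k IHk]; first by rewrite subrr normr0 mulr0.
rewrite addSn -natr1 mulrDr mulr1.
rewrite -(subrK (queue X (k + s) w l) (queue X (k + s).+1 w l)) -addrA.
apply: (le_trans (ler_normD _ _)); rewrite [leRHS]addrC lerD//.
apply: le_trans (incr_le (k + s) l).
have := queue_ge0 (k + s) w l; rewrite queueS.
set q := queue X (k + s) w l; set x := queue_increment _ _ _ => q0.
(* A clipped queue falls from [q] to 0, and then [q <= - x]. *)
have [qx|qx] := leP (q + x) 0.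
  by rewrite sub0r normrN ger0_norm// -normrN ger0_norm; clear -q0 qx; lra.
by rewrite addrAC subrr add0r.
Qed.

Lemma queue_le t l : queue X t w l <= c * t%:R.
Proof.
have := @queue_lip 0%N t l (leq0n t).
by rewrite subn0 subr0 ger0_norm// queue_ge0.
Qed.

(** Clipping at 0 cannot increase the square, and the increments have square at most [c ^+ 2]. The
    cost per slot is the future [C3]. *)
Lemma queue_sqr t :
  \sum_l queue X t w l ^+ 2 / 2 <= t%:R * (c ^+ 2 * L%:R / 2) +
  \sum_(s < t) \sum_l queue X s w l * queue_increment s w l.
Proof.
elim: t => [|t IHt].
  rewrite big_ord0 mul0r addr0 big1// => l _.
  by rewrite /= expr0n mul0r.
rewrite big_ord_recr/= -[t.+1%:R]natr1 mulrDl mul1r addrACA.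
apply: le_trans (lerD IHt (lexx _)); rewrite -lerBlDl -sumrB.
apply: (@le_trans _ _ (\sum_l (c ^+ 2 / 2 + queue X t w l * queue_increment t w l))).
  apply: ler_sum => l _; rewrite -/(queue X t.+1 w l) queueS.
  set q := queue X t w l; set x := queue_increment t w l.
  have xc : x ^+ 2 <= c ^+ 2.
    rewrite -[leLHS]real_normK ?num_real// lerXn2r ?nnegrE//; last exact: incr_le.
    exact: le_trans (incr_le t l).
  have [qx|qx] := leP (q + x) 0.
    have := sqr_ge0 (q + x); rewrite sqrrD expr0n /=; clear -xc; lra.
  by rewrite sqrrD; clear -xc; lra.
by rewrite big_split/= sumr_const card_ord lerD2r -[leLHS]mulr_natr mulrAC.
Qed.

End queue_paths.

(** * Drift of the queues under the algorithm *)

Section queue_drift.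
Context (R : realType) (N L : nat) (M : renewal_model R N L).
Variables (ymax zmax dmax B V : R).
Hypotheses (hbounded : bounded_model M ymax zmax dmax) (hB : 1 <= B)
  (hresidual : residual_bound M B) (hV : 0 < V).
Context d (Om : measurableType d) (P : probability Om R) (X : trajectory M Om).
Hypotheses (hX : admissible P X) (halg : follows_algorithm X V).

(* The absolute value only matters for L = 0, where nothing bounds zmax and
   dmax from below. *)
Let c := `|N%:R * zmax + dmax|.

Let c0 : 0 <= c. Proof. exact: normr_ge0. Qed.

Lemma increment_ae :
  {ae P, forall w, forall t l, `|queue_increment X t w l| <= c}.
Proof.
have zae : {ae P, forall w, forall n t l, `|perf X n t w l| <= zmax}.
  by apply: filter_forall => n; exact: (perf_ae hbounded hX n).
apply: filterS2 zae (ext_ae hbounded hX) => w zw dw t l.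
rewrite (le_trans (ler_normB _ _))// (le_trans _ (ler_norm _))// lerD//.
rewrite (le_trans (ler_norm_sum _ _ _))// (@le_trans _ _ (\sum_(n < N) zmax))//.
  exact: ler_sum.
by rewrite sumr_const card_ord mulr_natl.
Qed.

Lemma queue_ae : {ae P, forall w, forall t l, queue X t w l <= c * t%:R}.
Proof.
by apply: filterS increment_ae => w h t l; exact: queue_le.
Qed.

Lemma queue_measurable t l : measurable_fun setT (fun w => queue X t w l).
Proof.
exact: (hist_fun_measurable hX (@queue_fun_hist _ _ _ _ _ _ _ _ hX t l)).
Qed.

Lemma queue_integrable t l :
  P.-integrable setT (EFin \o (fun w => queue X t w l)).
Proof.
apply: (@ae_le_integrable _ _ _ _ _ (cst (c * t%:R))).
- exact: queue_measurable.
- exact: finite_measure_integrable_cst.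
by apply: filterS queue_ae => w h; rewrite ger0_norm ?queue_ge0.
Qed.

Lemma queue_sqr_integrable t l :
  P.-integrable setT (EFin \o (fun w => queue X t w l ^+ 2)).
Proof.
apply: (@ae_le_integrable _ _ _ _ _ (cst ((c * t%:R) ^+ 2))).
- by apply: measurable_funX; exact: queue_measurable.
- exact: finite_measure_integrable_cst.
apply: filterS queue_ae => w h.
rewrite ger0_norm ?sqr_ge0// lerXn2r ?nnegrE ?queue_ge0//.
apply: le_trans (h t l); exact: queue_ge0.
Qed.

Lemma queue_mean_le t l : 0 <= \int[P]_w queue X t w l <= c * t%:R.
Proof.
apply/andP; split; first by apply: Rintegral_ge0 => w _; exact: queue_ge0.
rewrite -(Rintegral_cst_prob P (c * t%:R)); apply: ae_le_Rintegral.
- exact: queue_integrable.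
- exact: finite_measure_integrable_cst.
- by apply: filterS queue_ae => w; exact.
Qed.

Lemma queue_ext t l :
  P.-integrable setT (EFin \o (fun w => queue X t w l * tnth (ext X t w) l)) /\
  \int[P]_w (queue X t w l * tnth (ext X t w) l) =
    dmean M l * \int[P]_w queue X t w l.
Proof.
apply: (ext_tower hbounded hX (@queue_fun_hist _ _ _ _ _ _ _ _ hX t l)
  (fun w => queue_ge0 X t w l)).
by apply: filterS queue_ae => w; exact.
Qed.

Section comparison.
Variables (T : nat) (f : 'I_N -> R) (g : 'I_N -> 'I_L -> R) (r eps : R).
Hypotheses (fr : \sum_n f n <= r)
  (gd : forall l, \sum_n g n l <= dmean M l + eps)
  (fy : forall n, `|f n| <= ymax) (gz : forall n l, `|g n l| <= zmax)
  (fgmin : forall n (x : action M n) (q : 'I_L -> R),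
     (forall l, 0 <= q l <= c * T%:R) ->
     (forall x' : action M n, V * fhat x + \sum_l q l * ghat x l <=
                              V * fhat x' + \sum_l q l * ghat x' l) ->
     V * fhat x + \sum_l q l * ghat x l <=
     V * f n + \sum_l q l * g n l + eps)
  (eps0 : 0 <= eps).

Let slot n t w :=
  weighted_slot X n (- (V * f n)) V (fun=> 0) (g n) (queue X) t w.

Lemma slot_integrable n t : (t < T)%N -> P.-integrable setT (EFin \o slot n t).
Proof.
move=> tT.
apply: (@weighted_slot_integrable _ _ _ M ymax zmax dmax hbounded _ _ P X hX n T _ _ _ _ _
  (c * T%:R)) => //.
- by move=> s l; exact: (queue_fun_hist hX).
- by move=> s w l; exact: queue_ge0.
- apply: filterS queue_ae => w h s l sT; rewrite (le_trans (h s l))//.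
  by rewrite ler_wpM2l// ler_nat ltnW.
Qed.

(** At every renewal before [T] the queues lie in the box [[0, c * T]] and the chosen action is a
    minimizer for them, so [fgmin] supplies the hypothesis on rates of [frame_drift]. *)
Lemma slot_drift n :
  \sum_(t < T) \int[P]_w slot n t w <=
  T%:R * (eps * B + L%:R * (c * (2 * zmax)) / 2 * B) +
  (V * ymax *+ 2 + L%:R * (c * T%:R * (2 * zmax))) * B.
Proof.
have y0 := ymax_ge0 hbounded (act X n 0%N point).
have le := @frame_drift R N L M ymax zmax dmax B hbounded hB hresidual _ _ P X hX n T
  (- (V * f n)) V (fun=> 0) (g n) (queue X) (c * T%:R) c eps.
apply: le_trans (le _ _ _ _ _ _ _ _ _) _ => //.
- by move=> s l; exact: (queue_fun_hist hX).
- by move=> s w l; exact: queue_ge0.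
- apply: filterS queue_ae => w h s l sT; rewrite (le_trans (h s l))//.
  by rewrite ler_wpM2l// ler_nat ltnW.
- apply: filterS increment_ae => w h s t l /andP[st _].
  exact: queue_lip.
- by rewrite mulr_ge0.
- apply: filterS queue_ae => w h k kT.
  set x := act X n k w; set q := queue X (renewal X n k w) w.
  have qle l : 0 <= q l <= c * T%:R.
    rewrite queue_ge0 (le_trans (h (renewal X n k w) l))//.
    by rewrite ler_wpM2l// ler_nat ltnW.
  have le1 := fgmin qle (halg (n := n) k w).
  rewrite [X in _ + X + _]big1; last by move=> l _; rewrite mul0r.
  under [X in _ + _ + X <= _]eq_bigr do rewrite mulrBr.
  by rewrite sumrB addr0; move: le1; rewrite -/x -/q; lra.
(* Here [reward_max] is [V * |f n| + V * ymax], whence twice [V * ymax]. *)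
rewrite lerD2l ler_wpM2r ?(le_trans _ hB)// lerD2r /reward_max.
rewrite big1 ?addr0; last by move=> l _; rewrite normr0 mul0r.
rewrite normrN normrM gtr0_norm// mulr2n lerD2r.
by rewrite ler_wpM2l ?(ltW hV).
Qed.

Lemma drift_eps :
  \sum_l \int[P]_w (queue X T w l ^+ 2) / 2 +
    V * (\sum_(t < T) \sum_n pen_mean P X n t - T%:R * r) <=
  T%:R * (c ^+ 2 * L%:R / 2) +
  N%:R * (T%:R * (eps * B + L%:R * (c * (2 * zmax)) / 2 * B) +
    (V * ymax *+ 2 + L%:R * (c * T%:R * (2 * zmax))) * B) +
  T%:R * (L%:R * (c * T%:R * eps)).
Proof.
pose lhs w := \sum_l 2^-1 * queue X T w l ^+ 2 +
  \sum_(t < T) \sum_n (V * pen X n t w - V * f n).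
(* The queue increment is split as [\sum_n (z - g) + (\sum_n g - d)]: the first part, with the
   penalties, makes up the slots of [slot_drift]; the second pairs the queues with the
   constraints. *)
pose rhs w := T%:R * (c ^+ 2 * L%:R / 2) + \sum_n \sum_(t < T) slot n t w +
  \sum_(t < T) \sum_l ((\sum_n g n l) * queue X t w l -
                        queue X t w l * tnth (ext X t w) l).
have path : {ae P, forall w, lhs w <= rhs w}.
  apply: filterS increment_ae => w h; rewrite /rhs -addrA.
  have -> : \sum_n \sum_(t < T) slot n t w + \sum_(t < T) \sum_l ((\sum_n g n l) *
      queue X t w l - queue X t w l * tnth (ext X t w) l) =
      \sum_(t < T) \sum_l queue X t w l * queue_increment X t w l +
      \sum_(t < T) \sum_n (V * pen X n t w - V * f n).
    rewrite exchange_big -!big_split/=; apply: eq_bigr => t _.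
    rewrite [X in X + _ = _]big_split/= [X in _ + X + _ = _]exchange_big/=.
    rewrite -addrA -big_split/= addrC; congr (_ + _).
      apply: eq_bigr => l _; rewrite -mulr_sumr sumrB /queue_increment.
      by rewrite !mulrBr; ring.
    apply: eq_bigr => n _; rewrite /slot_reward big1 ?addr0 1?addrC// => l _.
    by rewrite mul0r.
  rewrite addrA lerD2r; have := queue_sqr h T.
  by under eq_bigr do rewrite mulrC.
have iQ2 l := integrable_scaler 2^-1 (queue_sqr_integrable T l).
have iVp n t : P.-integrable setT (EFin \o (fun w => V * pen X n t w - V * f n)).
  apply: integrable_subr; last exact: finite_measure_integrable_cst.
  by apply: integrable_scaler; exact: (pen_integrable hbounded hX).
have isl n (t : 'I_T) : P.-integrable setT (EFin \o slot n t).
  exact: slot_integrable.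
have iQd t l : P.-integrable setT (EFin \o (fun w => (\sum_n g n l) * queue X t w l -
    queue X t w l * tnth (ext X t w) l)).
  apply: integrable_subr; last by case: (queue_ext t l).
  by apply: integrable_scaler; exact: queue_integrable.
have ic : P.-integrable setT (EFin \o cst (T%:R * (c ^+ 2 * L%:R / 2))).
  exact: finite_measure_integrable_cst.
have s1 := integrable_sumr (index_enum 'I_L) (Q := xpredT) (fun l _ => iQ2 l).
have s2 t := integrable_sumr (index_enum 'I_N) (Q := xpredT) (fun n _ => iVp n t).
have s3 := integrable_sumr (index_enum 'I_T) (Q := xpredT) (fun t _ => s2 t).
have s4 n := integrable_sumr (index_enum 'I_T) (Q := xpredT) (fun t _ => isl n t).
have s5 := integrable_sumr (index_enum 'I_N) (Q := xpredT) (fun n _ => s4 n).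
have s6 (t : 'I_T) := integrable_sumr (index_enum 'I_L) (Q := xpredT) (fun l _ => iQd t l).
have s7 := integrable_sumr (index_enum 'I_T) (Q := xpredT) (fun t _ => s6 t).
have ilhs : P.-integrable setT (EFin \o lhs) by exact: integrable_addr.
have irhs : P.-integrable setT (EFin \o rhs).
  by apply: integrable_addr => //; exact: integrable_addr.
have := ae_le_Rintegral ilhs irhs path.
have -> : \int[P]_w lhs w = \sum_l \int[P]_w (queue X T w l ^+ 2) / 2 +
    V * (\sum_(t < T) \sum_n pen_mean P X n t) - V * (T%:R * \sum_n f n).
  rewrite RintegralD// Rintegral_sum// -addrA; congr (_ + _).
    apply: eq_bigr => l _; rewrite RintegralZl//; last exact: queue_sqr_integrable.
    by rewrite mulrC.
  rewrite Rintegral_sum//.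
  transitivity (\sum_(t < T) \sum_n (V * pen_mean P X n t - V * f n)).
    apply: eq_bigr => t _; rewrite Rintegral_sum//; apply: eq_bigr => n _.
    have ip := pen_integrable hbounded hX n t.
    rewrite RintegralB//; last 2 first.
    - exact: integrable_scaler.
    - exact: finite_measure_integrable_cst.
    by rewrite Rintegral_cst_prob RintegralZl.
  under eq_bigr do rewrite sumrB -!mulr_sumr.
  rewrite sumrB -mulr_sumr; congr (_ - _).
  by rewrite sumr_const card_ord -[LHS]mulr_natl mulrCA.
have -> : \int[P]_w rhs w = T%:R * (c ^+ 2 * L%:R / 2) +
    \sum_n \sum_(t < T) \int[P]_w slot n t w +
    \sum_(t < T) \sum_l ((\sum_n g n l - dmean M l) * \int[P]_w queue X t w l).
  rewrite RintegralD//; last exact: integrable_addr.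
  rewrite RintegralD// Rintegral_cst_prob !Rintegral_sum//; congr (_ + _ + _).
    by apply: eq_bigr => n _; rewrite Rintegral_sum.
  apply: eq_bigr => t _; rewrite Rintegral_sum//; apply: eq_bigr => l _.
  have [i1 e1] := queue_ext t l.
  rewrite RintegralB//; last by apply: integrable_scaler; exact: queue_integrable.
  by rewrite e1 RintegralZl ?mulrBl//; exact: queue_integrable.
move=> le.
have l1 : \sum_n \sum_(t < T) \int[P]_w slot n t w <=
  N%:R * (T%:R * (eps * B + L%:R * (c * (2 * zmax)) / 2 * B) +
  (V * ymax *+ 2 + L%:R * (c * T%:R * (2 * zmax))) * B).
  rewrite mulr_natl -[N in _ *+ N]card_ord -sumr_const.
  by apply: ler_sum => n _; exact: slot_drift.
(* By independence [d[t]] has been replaced by its mean; the violation is at most [eps] and the mean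
   queue is between 0 and [c * T]. *)
have l2 : \sum_(t < T) \sum_l ((\sum_n g n l - dmean M l) * \int[P]_w queue X t w l) <=
    T%:R * (L%:R * (c * T%:R * eps)).
  rewrite mulr_natl -[T in _ *+ T]card_ord -sumr_const; apply: ler_sum => t _.
  rewrite mulr_natl -[L in _ *+ L]card_ord -sumr_const; apply: ler_sum => l _.
  have /andP[Q0 QT] := queue_mean_le t l.
  apply: (@le_trans _ _ (eps * \int[P]_w queue X t w l)).
    by rewrite ler_wpM2r// lerBlDl.
  rewrite [leRHS]mulrC ler_wpM2l// (le_trans QT)// ler_wpM2l// ler_nat ltnW//.
have l3 : V * (T%:R * \sum_n f n) <= V * (T%:R * r).
  by rewrite !ler_wpM2l// ltW.
rewrite mulrBr addrA.
apply: le_trans (lerB (lexx _) l3) _; apply: le_trans le _.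
by rewrite lerD// lerD2l.
Qed.

End comparison.
End queue_drift.

(** [K] may depend on [eta]: for the constraints it contains a term that grows as [eta] shrinks. *)
Lemma limn_esup_le_rate (R : realType) (a : nat -> R) (u : nat -> \bar R) (x : R) :
  (forall T, u T = (a T)%:E) ->
  (forall eta, 0 < eta -> exists K, forall T, (0 < T)%N ->
     a T <= x + eta + K / T%:R) ->
  (limn_esup u <= x%:E)%E.
Proof.
move=> ua ax; apply/lee_addgt0Pr => e e0; apply: limn_esup_le.
have e20 : 0 < e / 2 by rewrite divr_gt0.
have [K aK] := ax _ e20.
have : \forall T \near \oo, (0 < T)%N /\ `|K| / (e / 2) <= T%:R.
  by apply: filterI; [exact: nbhs_infty_gt|exact: nbhs_infty_ger].
apply: filterS => T [T0 KT]; rewrite ua -EFinD lee_fin (le_trans (aK T T0))//.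
rewrite -addrA lerD2l [leRHS](splitr e) lerD2l ler_pdivrMr ?ltr0n// mulrC.
by rewrite -ler_pdivrMr// (le_trans _ KT)// ler_pM2r ?invr_gt0// ler_norm.
Qed.

(** * From the drift bound to long-run averages *)

Section performance.
Context (R : realType) (N L : nat) (M : renewal_model R N L).
Variables (ymax zmax dmax B V : R).
Hypotheses (hbounded : bounded_model M ymax zmax dmax) (hB : 1 <= B)
  (hresidual : residual_bound M B) (hV : 0 < V).
Context d (Om : measurableType d) (P : probability Om R) (X : trajectory M Om).
Hypotheses (hX : admissible P X).

Lemma sum_pen_mean_le t : `|\sum_n pen_mean P X n t| <= N%:R * ymax.
Proof.
rewrite (le_trans (ler_norm_sum _ _ _))// (@le_trans _ _ (\sum_(n < N) ymax))//.
  by apply: ler_sum => n _; exact: (pen_mean_le hbounded hX).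
by rewrite sumr_const card_ord mulr_natl.
Qed.

Lemma penalty_cost_le : (penalty_cost P X <= (N%:R * ymax)%:E)%E.
Proof.
apply: (limn_esup_le_rate (penalty_averageE hbounded hX)) => eta eta0.
exists 0 => T T0; rewrite mul0r addr0.
have := average_le T sum_pen_mean_le (le_trans (normr_ge0 _) (sum_pen_mean_le 0%N)).
move=> /(le_trans (ler_norm _)) /le_trans; apply.
by rewrite lerDl ltW.
Qed.

Lemma ext_mean t l :
  P.-integrable setT (EFin \o (fun w => tnth (ext X t w) l)) /\
  \int[P]_w tnth (ext X t w) l = dmean M l.
Proof.
have m1 : measurable_fun setT ((cst 1) : g_sigma_algebraType (hist X t) -> R) by [].
have [i e] := ext_tower hbounded hX m1 (fun=> ler01) (aeW P (fun=> lexx (1 : R))) l.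
have E : (fun w => cst 1 w * tnth (ext X t w) l) = fun w => tnth (ext X t w) l.
  by apply/funext => w; rewrite mul1r.
by move: i e; rewrite E Rintegral_cst_prob mulr1.
Qed.

Hypothesis halg : follows_algorithm X V.

Let c := `|N%:R * zmax + dmax|.

Let c0 : 0 <= c. Proof. exact: normr_ge0. Qed.

Lemma perf_mean_queue T l :
  \sum_(t < T) \sum_n perf_mean P X n t l <=
  T%:R * dmean M l + \int[P]_w queue X T w l.
Proof.
rewrite -lerBlDl.
have ip n t := perf_integrable hbounded hX n t l.
have is1 t := integrable_sumr (index_enum 'I_N) (Q := xpredT) (fun n _ => ip n t).
have ii t : P.-integrable setT (EFin \o (fun w => queue_increment X t w l)).
  by apply: integrable_subr => //; case: (ext_mean t l).
have -> : \sum_(t < T) \sum_n perf_mean P X n t l - T%:R * dmean M l =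
    \int[P]_w \sum_(t < T) queue_increment X t w l.
  rewrite Rintegral_sum// mulr_natl -[T in _ *+ T]card_ord -sumr_const -sumrB.
  apply: eq_bigr => t _; have [i e] := ext_mean t l.
  by rewrite RintegralB// e Rintegral_sum.
apply: le_Rintegral => //.
- exact: integrable_sumr.
- exact: (queue_integrable hbounded hX).
- by move=> w _; exact: sum_increment_le.
Qed.

Context d' (Om' : measurableType d') (P' : probability Om' R)
  (X' : trajectory M Om').
Hypotheses (hX' : admissible P' X') (hcon : satisfies_constraints P' X').

(** For fixed [T] the pair error [eps] of [drift_eps] can be sent to 0; the feasible trajectory then
    survives only through [r]. *)
Lemma drift_bound T r : (penalty_cost P' X' < r%:E)%E ->
  \sum_l \int[P]_w (queue X T w l ^+ 2) / 2 +
    V * (\sum_(t < T) \sum_n pen_mean P X n t - T%:R * r) <=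
  T%:R * (c ^+ 2 * L%:R / 2) +
  N%:R * (T%:R * (L%:R * (c * (2 * zmax)) / 2 * B) +
    (V * ymax *+ 2 + L%:R * (c * T%:R * (2 * zmax))) * B).
Proof.
move=> pr; apply/ler_addgt0Pr => e e0.
have B0 : 0 <= B by rewrite (le_trans _ hB).
(* The total coefficient of [eps] in [drift_eps]. *)
have K0 : 0 <= N%:R * (T%:R * B) + T%:R * (L%:R * (c * T%:R)).
  by rewrite addr_ge0// ?mulr_ge0// ?mulr_ge0.
set K := _ + _ in K0.
pose eps := e / (K + 1).
have eps0 : 0 < eps by rewrite divr_gt0// ltr_wpDl.
have [f [g [fr gd fy gz fgmin]]] := reference_exists hbounded hB hresidual hX'
  (ltW hV) (mulr_ge0 c0 (ler0n R T)) eps0 hcon pr.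
have := drift_eps hbounded hB hresidual hV hX halg fr gd fy gz fgmin (ltW eps0).
move=> /le_trans; apply; rewrite -/c.
have : eps * K <= e.
  by rewrite /eps mulrAC ler_pdivrMr ?ltr_wpDl// ler_wpM2l ?ltW// ltrDl.
rewrite /K; set A := L%:R * (c * (2 * zmax)) / 2 * B.
set A' := (_ + _) * B; set A'' := T%:R * (_ / 2).
rewrite -subr_ge0 => h; rewrite -subr_ge0 (le_trans h)// le_eqVlt; apply/orP; left.
by apply/eqP; ring.
Qed.

End performance.

(** The 3 is 1 from freezing the queues during a frame plus 2 from the straddling frame, and the 6
    of [C1] absorbs it. The absolute value disappears when [N] and [L] are positive; otherwise both
    sides vanish. *)
Lemma drift_constant_le (R : realType) (N L : nat) (M : renewal_model R N L)
    (ymax zmax dmax B : R) (hbounded : bounded_model M ymax zmax dmax) (hB : 1 <= B)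
    (x : forall n, action M n) :
  N%:R * (3 * (L%:R * (`|N%:R * zmax + dmax| * zmax) * B)) <=
  N%:R * (6 * L%:R * zmax * (N%:R * zmax + dmax) * B).
Proof.
have [->|N0] := posnP N; first by rewrite !mul0r.
have [->|L0] := posnP L; first by rewrite !(mul0r, mulr0).
have z0 := zmax_ge0 hbounded (x (Ordinal N0)) (Ordinal L0).
have d0 := dmax_ge0 hbounded (Ordinal L0).
have c0 : 0 <= N%:R * zmax + dmax by rewrite addr_ge0// mulr_ge0.
rewrite ler_wpM2l// (ger0_norm c0).
have B0 : 0 <= B by rewrite (le_trans _ hB).
have p : 0 <= L%:R * ((N%:R * zmax + dmax) * zmax) * B by rewrite !mulr_ge0.
rewrite (_ : 6 * L%:R * zmax * _ * B = 6 * (L%:R * ((N%:R * zmax + dmax) * zmax) * B)).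
  by rewrite ler_wpM2r// ler_nat.
by ring.
Qed.

Theorem theorem2p3p1 (R : realType) (N L : nat) (M : renewal_model R N L)
  (ymax zmax dmax B V : R)
  (hfeasible : feasible M)
  (hbounded : bounded_model M ymax zmax dmax)
  (hB : 1 <= B)
  (hresidual : residual_bound M B)
  (hcompact : forall n : 'I_N, compact (performance_region M n))
  (hV : 0 < V)
  (d : measure_display) (Om : measurableType d) (P : probability Om R)
  (X : trajectory M Om)
  (hX : admissible P X)
  (halg : follows_algorithm X V) :
  let C1 := 6 * L%:R * zmax * (N%:R * zmax + dmax) * B in
  let C3 := (N%:R * zmax + dmax) ^+ 2 * L%:R / 2 in
  (forall l : 'I_L, (performance_cost P X l <= (dmean M l)%:E)%E) /\
  (penalty_cost P X <= fstar M + ((N%:R * C1 + C3) / V)%:E)%E.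
Proof.
move=> C1 C3; pose c := `|N%:R * zmax + dmax|; pose K := N%:R * C1 + C3.
(* The part of the error free of [T]: the penalties of the straddling frames. *)
pose K' := N%:R * (V * ymax *+ 2) * B.
have drift d' (Om' : measurableType d') (P' : probability Om' R)
    (X' : trajectory M Om') r T : admissible P' X' -> satisfies_constraints P' X' ->
    (penalty_cost P' X' < r%:E)%E ->
    \sum_l \int[P]_w (queue X T w l ^+ 2) / 2 +
    V * (\sum_(t < T) \sum_n pen_mean P X n t - T%:R * r) <= T%:R * K + K'.
  move=> hX' hcon pr.
  apply: le_trans (drift_bound hbounded hB hresidual hV hX halg hX' hcon T pr) _.
  have := drift_constant_le hbounded hB (fun n => act X n 0%N point).
  rewrite -/C1 -/c => /(ler_wpM2l (ler0n R T)) le.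
  have c2 : c ^+ 2 = (N%:R * zmax + dmax) ^+ 2 by rewrite real_normK ?num_real.
  have -> : T%:R * K = T%:R * (N%:R * C1) + T%:R * (c ^+ 2 * L%:R / 2).
    by rewrite -mulrDr /K /C3 -c2.
  rewrite [X in _ <= X + _]addrC -[leRHS]addrA lerD2l /K'.
  have -> : N%:R * (T%:R * (L%:R * (c * (2 * zmax)) / 2 * B) +
    (V * ymax *+ 2 + L%:R * (c * T%:R * (2 * zmax))) * B) =
    T%:R * (N%:R * (3 * (L%:R * (c * zmax) * B))) + N%:R * (V * ymax *+ 2) * B.
    by field.
  by rewrite lerD2r.
have Q2_ge0 T l : 0 <= \int[P]_w (queue X T w l ^+ 2).
  by apply: Rintegral_ge0 => w _; exact: sqr_ge0.
split=> [l|]; last first.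
  (* With the constant moved to the left, it remains to bound below the cost of each feasible
     trajectory, through the reals [r] strictly above it. *)
  rewrite -leeBlDr//; apply: le_ereal_inf_tmp => _ [d' [Om' [P' [X' [hX' hcon ->]]]]].
  apply: lee_real_gt => r pr; rewrite leeBlDr// -EFinD.
  apply: (limn_esup_le_rate (penalty_averageE hbounded hX)) => eta eta0.
  exists (K' / V) => T T0; have T0' : 0 < T%:R :> R by rewrite ltr0n.
  have s0 : 0 <= \sum_l \int[P]_w (queue X T w l ^+ 2) / 2.
    by apply: sumr_ge0 => l _; rewrite divr_ge0.
  have : V * (\sum_(t < T) \sum_n pen_mean P X n t - T%:R * r) <= T%:R * K + K'.
    by apply: le_trans (drift _ _ _ _ _ T hX' hcon pr); rewrite lerDr.
  rewrite mulrC -ler_pdivlMr// lerBlDr => le.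
  rewrite mulrC ler_pdivrMr//; apply: le_trans le _.
  rewrite -subr_ge0 (_ : _ - _ = eta * T%:R); first by rewrite mulr_ge0// ltW.
  by rewrite -/K; field; rewrite !gt_eqF.
have [_ [d' [Om' [P' [X' [hX' hcon _]]]]]] := hfeasible.
(* For the constraints any [r] above the cost of some feasible trajectory will do: only a second
   moment of the queues linear in [T] is wanted. *)
pose r := N%:R * ymax + 1.
have pr : (penalty_cost P' X' < r%:E)%E.
  by rewrite (le_lt_trans (penalty_cost_le hbounded hX'))// lte_fin ltrDl.
apply: (limn_esup_le_rate (fun T => performance_averageE hbounded hX T l)) => eta eta0.
(* Slope in [T] of the bound on the second moment, made positive so that it can be divided by. *)
pose A := `|2 * (K + V * (r + N%:R * ymax))| + 1.
have A0 : 0 < A by rewrite ltr_wpDl.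
exists (eta / A * (2 * K') + A / eta) => T T0.
have T0' : 0 < T%:R :> R by rewrite ltr0n.
have Q2 : \int[P]_w (queue X T w l ^+ 2) <= T%:R * A + 2 * K'.
  have := drift _ _ _ _ _ T hX' hcon pr.
  rewrite (bigD1 l)//=.
  have s0 : 0 <= \sum_(i < L | i != l) \int[P]_w (queue X T w i ^+ 2) / 2.
    by apply: sumr_ge0 => i _; rewrite divr_ge0.
  have pen_ge : - (T%:R * (N%:R * ymax)) <= \sum_(t < T) \sum_n pen_mean P X n t.
    rewrite mulr_natl -[T in _ *+ T]card_ord -sumr_const -sumrN; apply: ler_sum => t _.
    by have := sum_pen_mean_le hbounded hX t; rewrite ler_norml => /andP[].
  have VP := ler_wpM2l (ltW hV) pen_ge.
  have AT : T%:R * (2 * (K + V * (r + N%:R * ymax))) <= T%:R * A.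
    by rewrite ler_wpM2l// (le_trans (ler_norm _))// lerDl.
  move: s0 VP AT; set S := \sum_(_ < _ | _) _; set I := \int[P]_w _.
  set Y := \sum_(_ < _) _; clearbody S I Y A; clear => s0 VP AT le.
  lra.
(* From [q <= eta / A * q ^+ 2 + A / eta], whose weight is tuned so that the part of the second
   moment linear in [T] contributes exactly [eta * T]. *)
have Q1 : \int[P]_w queue X T w l <= eta / A * (T%:R * A + 2 * K') + A / eta.
  have a0 : 0 < eta / A by rewrite divr_gt0.
  have iQ2 := queue_sqr_integrable hbounded hX T l.
  apply: (@le_trans _ _ (eta / A * \int[P]_w (queue X T w l ^+ 2) + A / eta)); last first.
    by rewrite lerD2r ler_wpM2l// ltW.
  rewrite -RintegralZl// -[A / eta in leRHS](Rintegral_cst_prob P) -RintegralD//;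
    last 2 first.
  - exact: integrable_scaler.
  - exact: finite_measure_integrable_cst.
  apply: le_Rintegral => //.
  - exact: (queue_integrable hbounded hX).
  - apply: integrable_addr; first exact: integrable_scaler.
    exact: finite_measure_integrable_cst.
  move=> w _; set q := queue X T w l; rewrite -subr_ge0.
  rewrite (_ : _ - q = eta / A * (q - A / eta / 2) ^+ 2 + A / eta * (3 / 4)); last first.
    by field; rewrite !gt_eqF.
  by rewrite addr_ge0// mulr_ge0 ?sqr_ge0// ltW// ?divr_gt0.
rewrite mulrC ler_pdivrMr// (le_trans (perf_mean_queue hbounded hX T l))//.
apply: le_trans (lerD (lexx _) Q1) _; rewrite le_eqVlt; apply/orP; left; apply/eqP.
by field; rewrite !gt_eqF.
Qed.
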